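(* Let $\mathcal A$ be a hyperplane arrangement in $\mathbb C^n$ that is stable, reduced and indecomposable (with respect to a coordinate system of $\mathbb C^n$). Assume that $\#L(\mathcal A)^{(2)}>1$. Then there is a coordinate system $(x_1,\dots,x_n)$ of $\mathbb C^n$, obtained from the given one by an admissible coordinate transformation, and there exist a positive integer $m$, a non-negative integer $r$ and non-zero complex numbers $\alpha_1,\dots,\alpha_r$ such that $\mathcal A$ has the following form. Set \begin{align*} \Omega&:=\bigl\{e^{2\pi k\sqrt{-1}/m}\mid k=1,\dots,m\bigr\},\\ \mathcal A_c&:=\bigl\{\{x_i=\omega\alpha_j\}\mid \omega\in\Omega,\ i=1,\dots,n,\ j=1,\dots,r\bigr\},\\ \mathcal A_0&:=\bigl\{\{x_i=0\}\mid 1\le i\le n\bigr\},\\ \mathcal A'&:=\bigl\{\{x_i=\omega x_j\}\mid \omega\in\Omega,\ 1\le i<j\le n\bigr\}. \end{align*} If $n=2$, then $r\ge1$ and $$\mathcal A=\bigl\{\{x_1=\omega x_2\}\mid\omega\in\Omega'\bigr\}\cup\mathcal A_c\cup\mathcal A_0$$ for some subset $\Omega'$ with $1\in\Omega'\subset\Omega$. If $n\ge3$, then either $\mathcal A=\mathcal A'$ with $m=1$ and $n>3$, or $\mathcal A=\mathcal A'\cup\mathcal A_c\cup\mathcal A_0$.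
   Context: A hyperplane arrangement $\mathcal A$ in $V=\mathbb C^n$ is a finite set of affine hyperplanes. $L(\mathcal A)$ is the set of all non-empty intersections $\bigcap_{H\in\mathcal B}H$ with $\mathcal B\subset\mathcal A$ (the empty intersection being $V$), and $L(\mathcal A)^{(k)}$ is the set of elements of $L(\mathcal A)$ of codimension $k$. For a non-zero vector $v\in V$ and an affine subspace $S$, put $\langle v,S\rangle:=\{tv+y\mid t\in\mathbb C,\ y\in S\}$. $\mathcal A$ is called $v$-closed if $\langle v,S\rangle\in L(\mathcal A)$ for every $S\in L(\mathcal A)^{(2)}$. Given a coordinate system $(x_1,\dots,x_n)$, the $i$-th standard basis vector is also denoted by $x_i$. $\mathcal A$ is stable (with respect to this coordinate system) if it is $x_i$-closed for every $i=1,\dots,n$. (Abstractly, $\mathcal A$ is called stable if there are $n$ linearly independent vectors $v_1,\dots,v_n$ such that $\mathcal A$ is $v_i$-closed for all $i$; one then uses the linear coordinates defined by the basis $v_1,\dots,v_n$.) An admissible coordinate transformation is one of the form $x_j\mapsto a_jx_{\sigma(j)}+b_j$ $(j=1,\dots,n)$ with $a_j,b_j\in\mathbb C$, $a_j\neq0$ and $\sigma$ a permutation of the indices. $\mathcal A_{x_i}:=\{H\in\mathcal A\mid\langle x_i,H\rangle=V\}$, i.e. the set of $H\in\mathcal A$ whose defining equation has non-zero coefficient of $x_i$. $\mathcal A$ is indecomposable if $\mathcal A_{x_i}\cap\mathcal A_{x_j}\neq\emptyset$ for all $1\le i<j\le n$. $\mathcal A$ is reducible if, after some admissible coordinate transformation,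 there are $a,b\in\mathbb C$ with $a\ne0$ and a hyperplane arrangement $\mathcal A''$ in $\mathbb C^{n-1}$ such that $\mathcal A=\pi^{-1}(\mathcal A'')=\{\pi^{-1}(H)\mid H\in\mathcal A''\}$, where $\pi:\mathbb C^n\to\mathbb C^{n-1}$, $(x_1,\dots,x_n)\mapsto(x_1,\dots,x_{n-2},ax_{n-1}+bx_n)$. $\mathcal A$ is reduced if it is not reducible. *)

(* Defs.v *)
(* MathComp / MathComp-Analysis.  The complex numbers are [R[i]], for an
   arbitrary [R : realType]. *)
From HB Require Import structures.
From mathcomp Require Import all_boot all_order all_algebra all_fingroup.
From mathcomp Require Import all_classical all_reals all_analysis.
From mathcomp Require Export complex.

Set Implicit Arguments.
Unset Strict Implicit.
Unset Printing Implicit Defensive.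

Import Order.TTheory GRing.Theory Num.Theory.
Local Open Scope classical_set_scope.
Local Open Scope ring_scope.

Section Arrangements.
Variables (R : realType) (n : nat).
Local Notation C := R[i].
Local Notation V := 'rV[C]_n.
Implicit Types (A : set (set V)) (S H : set V) (v : V).

Definition affine_of_codim (k : nat) S : Prop :=
  exists (p : V) (W : {vspace V}),
    (\dim W + k)%N = n /\ S = [set x | x - p \in W].

Definition hyperplane H : Prop := affine_of_codim 1 H.

Definition arrangement A : Prop := finite_set A /\ A `<=` hyperplane.

Definition intersections A : set (set V) :=
  [set S | S !=set0 /\
     exists B : set (set V), B `<=` A /\ S = \bigcap_(H in B) H].

Definition intersections_codim A (k : nat) : set (set V) :=
  intersections A `&` affine_of_codim k.

Definition translates v S : set V :=
  [set x | exists (t : C) (y : V), S y /\ x = t *: v + y].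

(* Only used at non-zero vectors v. *)
Definition v_closed v A : Prop :=
  forall S, intersections_codim A 2 S -> intersections A (translates v S).

(* An affine coordinate system of C^n: the point p has the coordinates
   p *m cs_mx + cs_shift. *)
Record coordsys := CoordSys {
  cs_mx : 'M[C]_n;
  cs_shift : V;
  cs_unit : cs_mx \in unitmx }.

Implicit Types X Y : coordsys.

Definition coords X (p : V) : V := p *m cs_mx X + cs_shift X.

Definition coord X (i : 'I_n) (p : V) : C := coords X p 0 i.

(* The vector along which the i-th coordinate increases by 1 and the others are
   unchanged; the shift plays no role for vectors. *)
Definition basis_vec X (i : 'I_n) : V := row i (invmx (cs_mx X)).

Definition stable X A : Prop := forall i : 'I_n, v_closed (basis_vec X i) A.

Definition admissible X Y : Prop :=
  exists (s : 'S_n) (a b : 'I_n -> C),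
    (forall j, a j != 0) /\
    (forall j p, coord Y j p = a j * coord X (s j) p + b j).

Definition transverse X A (i : 'I_n) : set (set V) :=
  [set H | A H /\ translates (basis_vec X i) H = setT].

Definition indecomposable X A : Prop :=
  forall i j : 'I_n, (i < j)%N -> (transverse X A i `&` transverse X A j) !=set0.

(* (x_1, ..., x_n) |-> (x_1, ..., x_(n-2), a x_(n-1) + b x_n).  For j : 'I_n.-1,
   [widen_ord (leq_pred n) j] is j seen in 'I_n, and its [ordS] is j + 1 (there
   is no wraparound, as j + 1 < n). *)
Definition merge_last (a b : C) (x : V) : 'rV[C]_n.-1 :=
  \row_(j < n.-1)
    let i := widen_ord (leq_pred n) j in
    if (j.+2 < n)%N then x 0 i else a * x 0 i + b * x 0 (ordS i).

End Arrangements.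

Definition reducible (R : realType) (n : nat)
    (X : coordsys R n) (A : set (set 'rV[R[i]]_n)) : Prop :=
  exists Y : coordsys R n, admissible X Y /\
  exists (a b : R[i]) (A'' : set (set 'rV[R[i]]_n.-1)),
    [/\ a != 0, arrangement A'' &
        A = [set [set p | H (merge_last a b (coords Y p))] | H in A'']].

Definition reduced (R : realType) (n : nat)
    (X : coordsys R n) (A : set (set 'rV[R[i]]_n)) : Prop := ~ reducible X A.

Section StandardForm.
Variables (R : realType) (n : nat) (Y : coordsys R n).
Local Notation C := R[i].
Local Notation V := 'rV[C]_n.

(* e^(t sqrt(-1)) for real t *)
Definition expi (t : R) : C := (cos t +i* sin t)%C.

Definition Omega (m : nat) : set C :=
  [set expi (2 * pi * k%:R / m%:R) | k in [set k | (1 <= k <= m)%N]].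

Definition const_arr (m r : nat) (alpha : 'I_r -> C) : set (set V) :=
  [set H | exists (w : C) (i : 'I_n) (j : 'I_r),
     Omega m w /\ H = [set p | coord Y i p = w * alpha j]].

Definition zero_arr : set (set V) :=
  [set H | exists i : 'I_n, H = [set p | coord Y i p = 0]].

(* The hyperplanes x_i = w x_j with i < j and w in W; W = Omega m gives A'. *)
Definition diag_arr (W : set C) : set (set V) :=
  [set H | exists (w : C) (i j : 'I_n),
     [/\ W w, (i < j)%N & H = [set p | coord Y i p = w * coord Y j p]]].

End StandardForm.

(* Main.v *)
Require Import Defs.
From mathcomp Require Import all_boot all_order all_algebra all_fingroup.
From mathcomp Require Import all_classical all_reals all_analysis.
From mathcomp Require Import ring lra.

(* A hyperplane a . x = c is handled through its equation (a, c), so that stability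
   says that equations can be eliminated: if a_i, b_i <> 0 then
   (b_i a - a_i b, b_i c - a_i d) is again an equation of the arrangement.

   No equation has three non-zero coefficients.  Scale such an equation to
   (1, 1, 1) on three coordinates and let T_1, T_2, T_3 be the finite sets of t such
   that (0, 1, t), (t, 0, 1), (1, t, 0) occur.  Elimination gives -1/(ts) in T_3 for
   t in T_1 and s in T_2, and 1/(1-t) in T_2 for t in T_1 different from 1 (and
   cyclically).  The first rule makes each T_k a coset of a finite group, so that
   its sum and the sum of its inverses vanish unless it is a singleton; the second
   rule then forces singletons.  Hence all equations depend on two of them, which
   contradicts the existence of two elements of codimension 2.

   So every equation involves at most two coordinates, and by indecomposability the
   coordinates can be rescaled such that all x_i = x_j occur.  The remaining
   equations x_i = w x_j + c define affine maps that preserve the finite set of p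
   with x_i = p in the arrangement; translating a common fixed point to 0 makes all
   c vanish, and the w lie in a finite group of roots of unity. *)

Set Implicit Arguments.
Unset Strict Implicit.
Unset Printing Implicit Defensive.

Import Order.TTheory GRing.Theory Num.Theory.
Local Open Scope classical_set_scope.
Local Open Scope ring_scope.

(** * Finite subsets of a field closed under affine maps *)

Section FiniteSets.
Variable F : numFieldType.
Implicit Types (s : seq F) (x y c d u v w : F).

(** Finiteness turns the injection into a permutation, so that sums and products over [s] can be
    reindexed by [f]. *)
Lemma perm_map_closed (f : F -> F) s :
  uniq s -> {in s &, injective f} -> {in s, forall x, f x \in s} ->
  perm_eq (map f s) s.
Proof.
move=> us fi fs; have um : uniq (map f s) by rewrite map_inj_in_uniq.
apply: uniq_perm => //.
have sub : {subset map f s <= s} by move=> _ /mapP[x xs ->]; exact: fs.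
by have [] := uniq_min_size um sub _; rewrite ?size_map.
Qed.

Lemma sum_affine_closed s w c :
  uniq s -> w != 0 -> {in s, forall x, w * x + c \in s} ->
  \sum_(x <- s) x = w * (\sum_(x <- s) x) + c *+ size s.
Proof.
move=> us w0 cl; rewrite -[LHS](perm_big _ (perm_map_closed us _ cl)) /=.
  rewrite big_map big_split /= mulr_sumr; congr (_ + _).
  by rewrite big_const_seq count_predT iter_addr_0.
by move=> x y _ _ /addIr/(mulfI w0).
Qed.

(** The translation permutes [s] and so adds [d *+ size s] to its sum; in characteristic 0 this
    forces [d] to vanish. *)
Lemma translation_closed s d :
  uniq s -> s != [::] -> {in s, forall x, x + d \in s} -> d = 0.
Proof.
move=> us s0 cl; have cl1 : {in s, forall x, 1 * x + d \in s}.
  by move=> x xs; rewrite mul1r cl.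
have /eqP := sum_affine_closed us (oner_neq0 _) cl1.
rewrite mul1r -[X in X == _]addr0 (inj_eq (addrI _)) eq_sym mulrn_eq0 size_eq0.
by rewrite (negPf s0) /= => /eqP.
Qed.

Lemma sum_scaling_closed s u :
  uniq s -> u != 0 -> u != 1 -> {in s, forall x, u * x \in s} ->
  \sum_(x <- s) x = 0.
Proof.
move=> us u0 u1 cl; have cl0 : {in s, forall x, u * x + 0 \in s}.
  by move=> x xs; rewrite addr0 cl.
have /eqP := sum_affine_closed us u0 cl0.
rewrite mul0rn addr0 -subr_eq0 -{1}[\sum_(_ <- _) _]mul1r -mulrBl mulf_eq0.
by rewrite subr_eq0 eq_sym (negPf u1) => /eqP.
Qed.

Lemma sum_inv_scaling_closed s u :
  uniq s -> u != 0 -> u != 1 -> {in s, forall x, u * x \in s} ->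
  \sum_(x <- s) x^-1 = 0.
Proof.
move=> us u0 u1 cl.
rewrite -(big_map (fun x => x^-1) predT id) /=.
apply: (@sum_scaling_closed _ u^-1); rewrite ?invr_eq0 ?invr_eq1 //.
  by rewrite map_inj_uniq //; exact: invr_inj.
by move=> _ /mapP[x xs ->]; rewrite -invfM mem_map ?cl //; exact: invr_inj.
Qed.

Lemma uniq_inj_size (f : F -> F) s t :
  uniq s -> {in s &, injective f} -> {in s, forall x, f x \in t} ->
  (size s <= size t)%N.
Proof.
move=> us fi fs; rewrite -(size_map f); apply: uniq_leq_size.
  by rewrite map_inj_in_uniq.
by move=> _ /mapP[x xs ->]; exact: fs.
Qed.

(* For linear forms in three coordinates, up to scaling: eliminating the common coordinate of
   (0, 1, x) and (y, 0, 1) gives (1, menelaus x y, 0), and eliminating y from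
   (1, 1, 1) and (0, 1, x) gives (cevian x, 0, 1). *)
Definition menelaus x y : F := - (x * y)^-1.

Definition cevian x : F := (1 - x)^-1.

Lemma menelaus_inj y : y != 0 -> injective (menelaus ^~ y).
Proof.
by move=> y0 x x' /oppr_inj/invr_inj/(mulIf y0).
Qed.

Lemma cevian_inj : injective cevian.
Proof. by move=> x y /invr_inj/addrI/oppr_inj. Qed.

Lemma cevian_neq1 x : x != 0 -> cevian x != 1.
Proof.
move=> x0; rewrite /cevian invr_eq1 -subr_eq0 addrAC subrr add0r.
by rewrite oppr_eq0.
Qed.

(** * Three finite sets linked by elimination *)

Section Triangle.
Variables (a b c : seq F).
Hypotheses (ua : uniq a) (ub : uniq b) (uc : uniq c).
Hypotheses (a0 : 0 \notin a) (b0 : 0 \notin b) (c0 : 0 \notin c).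
Hypotheses (ane : a != [::]) (bne : b != [::]) (cne : c != [::]).
Hypothesis abc : forall x y, x \in a -> y \in b -> menelaus x y \in c.
Hypothesis bca : forall x y, x \in b -> y \in c -> menelaus x y \in a.
Hypothesis cab : forall x y, x \in c -> y \in a -> menelaus x y \in b.
Hypothesis ab1 : forall x, x \in a -> x != 1 -> cevian x \in b.
Hypothesis bc1 : forall x, x \in b -> x != 1 -> cevian x \in c.
Hypothesis ca1 : forall x, x \in c -> x != 1 -> cevian x \in a.

Let neq0 (s : seq F) x : 0 \notin s -> x \in s -> x != 0.
Proof. by move=> s0 xs; apply: contraNneq s0 => <-. Qed.

Let size_le (s t r : seq F) : s != [::] -> 0 \notin s -> uniq t ->
  (forall x y, x \in t -> y \in s -> menelaus x y \in r) ->
  (size t <= size r)%N.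
Proof.
case: s => // y s _ s0 ut cl.
apply: (@uniq_inj_size (menelaus ^~ y)) => //.
  by move=> x x' _ _; apply: menelaus_inj; apply: neq0 s0 _; rewrite mem_head.
by move=> x xt; rewrite cl // mem_head.
Qed.

(** Fixing one argument makes [menelaus] injective, so the sizes increase weakly from [a] to [c] to
    [b] and back to [a]. *)
Lemma triangle_sizes : size a = size b /\ size b = size c.
Proof.
have ac := size_le bne b0 ua abc; have cb := size_le ane a0 uc cab.
have ba := size_le cne c0 ub bca.
by split; apply/eqP; rewrite eqn_leq ?ba ?cb ?(leq_trans ac) ?(leq_trans ba).
Qed.

Let rem1_size (s t : seq F) : uniq s -> uniq t -> 0 \notin s ->
  (forall x, x \in s -> x != 1 -> cevian x \in t) ->
  {in rem 1%R s, forall x, cevian x \in rem 1%R t}.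
Proof.
move=> us ut s0 cl x; rewrite !mem_rem_uniq // !inE => /andP[x1 xs].
by rewrite cevian_neq1 ?cl //; exact: neq0 s0 xs.
Qed.

(** Two eliminations compose to a scaling, so the ratios of elements of one set act on another by
    multiplication. *)
Let scaling (s t r : seq F) : uniq t -> 0 \notin s -> 0 \notin t ->
  (forall x y, x \in s -> y \in t -> menelaus x y \in r) ->
  (forall x y, x \in r -> y \in s -> menelaus x y \in t) ->
  forall x x', x \in s -> x' \in s -> {in t, forall y, x / x' * y \in t}.
Proof.
move=> ut s0 t0 cl1 cl2 x x' xs xs' y yt.
suff -> : x / x' * y = menelaus (menelaus x y) x'.
  by apply: cl2 => //; exact: cl1.
by rewrite /menelaus mulNr invrN opprK invfM invrK mulrAC.
Qed.

(* With at least two elements, a, b and c are unions of cosets of a non-trivial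
   finite subgroup of F^*, so that their elements and the inverses of these sum
   to 0; comparing the inverses over b \ 1 with 1 - x over a \ 1 then makes
   size a, or size a + 1, vanish in F. *)
Lemma triangle_size1 : (size a <= 1)%N.
Proof.
have [sab sbc] := triangle_sizes.
rewrite leqNgt; apply/negP => a2.
have two (s : seq F) : uniq s -> (1 < size s)%N -> exists x x', [/\ x \in s, x' \in s & x != x'].
  case: s => [|x [|x' s]] //= /andP[]; rewrite inE negb_or => /andP[xx' _] _ _.
  by exists x, x'; rewrite !inE !eqxx orbT.
have [x [x' [xa xa' xx']]] := two _ ua a2.
have [y [y' [yb yb' yy']]] : exists x x', [/\ x \in b, x' \in b & x != x'].
  by apply: two; rewrite // -sab.
have q1 (s : seq F) z z' : 0 \notin s -> z \in s -> z' \in s -> z != z' ->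
    (z / z' != 0) /\ (z / z' != 1).
  move=> s0 zs zs' zz'; have z0 := neq0 s0 zs; have z'0 := neq0 s0 zs'.
  split; first by rewrite mulf_neq0 ?invr_eq0.
  apply: contra_neq zz' => h; by rewrite -[z](divfK z'0) h mul1r.
have suma : \sum_(x <- a) x = 0.
  have [u0 u1] := q1 _ _ _ b0 yb yb' yy'.
  apply: (sum_scaling_closed ua u0 u1).
  have menC z z' : menelaus z z' = menelaus z' z by rewrite /menelaus mulrC.
  apply: (@scaling b a c) => // z z' zi zi'.
    by rewrite menC abc.
  by rewrite menC bca.
have sumb : \sum_(x <- b) x^-1 = 0.
  have [u0 u1] := q1 _ _ _ a0 xa xa' xx'.
  apply: (sum_inv_scaling_closed ub u0 u1).
  by apply: (@scaling a b c).
have le_rem (s t : seq F) : uniq s -> uniq t -> 0 \notin s ->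
  (forall x, x \in s -> x != 1 -> cevian x \in t) ->
  (size (rem 1%R s) <= size (rem 1%R t))%N.
  move=> us ut s0 cl; apply: (@uniq_inj_size cevian); first exact: rem_uniq.
    by move=> ? ? _ _ /cevian_inj.
  exact: rem1_size.
(* [cevian] is injective and avoids the value 1 on non-zero arguments, so it embeds each set without
   1 into the next, cyclically. *)
have sz : size (rem 1%R a) = size (rem 1%R b).
  apply/eqP; rewrite eqn_leq le_rem //.
  by rewrite (leq_trans (le_rem b c _ _ _ _)) ?le_rem.
have mem1 : (1%R \in a) = (1%R \in b).
  have szr s : size (rem 1%R s) = (size s - (1%R \in s))%N.
    by case: (boolP (1%R \in s)) => h; [rewrite size_rem // subn1|rewrite rem_id // subn0].
  move: sz; rewrite !szr -sab; case: (size a) a2 => // k _.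
  case: (1%R \in a); case: (1%R \in b) => //; rewrite subn1 subn0 /= => /eqP;
  by rewrite eqn_leq ltnn ?andbF.
have perm : perm_eq (map cevian (rem 1%R a)) (rem 1%R b).
  have um : uniq (map cevian (rem 1%R a)).
    by rewrite (map_inj_uniq cevian_inj) rem_uniq.
  apply: uniq_perm; rewrite ?rem_uniq //.
  have sub : {subset map cevian (rem 1%R a) <= rem 1%R b}.
    by move=> _ /mapP[z za ->]; exact: (rem1_size ua ub).
  by have [] := uniq_min_size um sub _; rewrite // size_map sz.
have sumrem (f : F -> F) s : f 1 = 1 -> \sum_(x <- s) f x = 0 ->
    \sum_(x <- rem 1%R s) f x = - (1%R \in s)%:R.
  move=> f1 s0; case: (boolP (1 \in s)) => h; last by rewrite rem_id // s0 oppr0.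
  move: s0; rewrite (perm_big _ (perm_to_rem h)) big_cons f1 /= => /eqP.
  by rewrite addrC addr_eq0 => /eqP.
(* The left side is minus the indicator of 1 in [b]; the right side is the size of [rem 1%R a] plus
   the indicator of 1 in [a]. *)
have : \sum_(x <- rem 1%R b) x^-1 = \sum_(x <- rem 1%R a) (1 - x).
  rewrite -(perm_big _ perm) big_map; apply: eq_bigr => z _.
  by rewrite /cevian invrK.
rewrite sumrem ?invr1 // sumrB (sumrem id) // opprK mem1.
rewrite big_const_seq count_predT iter_addr_0 => /eqP.
rewrite eq_sym -subr_eq0 opprK -addrA -!natrD pnatr_eq0 addn_eq0.
rewrite addn_eq0 eqb0 => /andP[sa0 /andP[b1 _]].
by move: sa0 a2; rewrite rem_id ?mem1 // => /eqP->.
Qed.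

End Triangle.

(** The hypotheses are cyclic in the three sets, so each is a singleton. If [a] were {1}, then [c]
    and next [b] would be {1} too, as [cevian] avoids 1, and [menelaus 1 1], which is -1, would lie
    in {1}. *)
Lemma triangle_singleton (a b c : seq F) :
  uniq a -> uniq b -> uniq c -> 0 \notin a -> 0 \notin b -> 0 \notin c ->
  a != [::] -> b != [::] -> c != [::] ->
  (forall x y, x \in a -> y \in b -> menelaus x y \in c) ->
  (forall x y, x \in b -> y \in c -> menelaus x y \in a) ->
  (forall x y, x \in c -> y \in a -> menelaus x y \in b) ->
  (forall x, x \in a -> x != 1 -> cevian x \in b) ->
  (forall x, x \in b -> x != 1 -> cevian x \in c) ->
  (forall x, x \in c -> x != 1 -> cevian x \in a) ->
  exists2 t, a = [:: t] & t != 1.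
Proof.
move=> ua ub uc a0 b0 c0 ane bne cne abc bca cab ab1 bc1 ca1.
have single (u : seq F) : u != [::] -> (size u <= 1)%N -> exists t, u = [:: t].
  by case: u => [|t [|]] // _ _; exists t.
have [t at_] : exists t, a = [:: t].
  apply: single => //.
  exact: (triangle_size1 ua ub uc a0 b0 c0 ane bne cne abc bca cab ab1 bc1 ca1).
have [s bs] : exists t, b = [:: t].
  apply: single => //.
  exact: (triangle_size1 ub uc ua b0 c0 a0 bne cne ane bca cab abc bc1 ca1 ab1).
have [r cr] : exists t, c = [:: t].
  apply: single => //.
  exact: (triangle_size1 uc ua ub c0 a0 b0 cne ane bne cab abc bca ca1 ab1 bc1).
exists t => //; apply/eqP => t1.
have ta : t \in a by rewrite at_ mem_head.
have sb : s \in b by rewrite bs mem_head.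
have rc : r \in c by rewrite cr mem_head.
have r1 : r = 1.
  apply/eqP/negPn/negP => r1; have := ca1 r rc r1.
  rewrite at_ inE t1; apply/negP; rewrite cevian_neq1 //.
  by apply: contraNneq c0 => <-.
have s1 : s = 1.
  apply/eqP/negPn/negP => s1; have := bc1 s sb s1.
  rewrite cr inE r1; apply/negP; rewrite cevian_neq1 //.
  by apply: contraNneq b0 => <-.
have := abc _ _ ta sb.
rewrite cr inE t1 r1 s1 /menelaus mulr1 invr1 eqNr.
by rewrite oner_eq0.
Qed.

End FiniteSets.

Lemma finite_uniq (T : choiceType) (A : set T) :
  finite_set A -> exists s : seq T, uniq s /\ forall x, A x <-> x \in s.
Proof.
move=> /finite_seqP[s ->]; exists (undup s); split; first exact: undup_uniq.
by move=> x /=; rewrite mem_undup.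
Qed.


(** * Equations with three non-zero coefficients *)

Section PlaneClosed.
Variable F : numFieldType.
Implicit Types (L : F -> F -> F -> Prop) (x y z t k : F).

(** [L x y z] models the occurrence of an equation with coefficients (x, y, z) at three chosen
    coordinates, scaled so that (1, 1, 1) occurs; constants and other coordinates are forgotten. The
    disjunctions say that the result of an elimination is not zero; the last three fields come from
    reducedness. *)
Record plane_closed L : Prop := PlaneClosed {
  plane_one : L 1 1 1;
  plane_scale : forall k x y z, k != 0 -> L x y z -> L (k * x) (k * y) (k * z);
  plane_elim1 : forall x y z x' y' z', L x y z -> L x' y' z' ->
    x != 0 -> x' != 0 -> x' * y - x * y' != 0 \/ x' * z - x * z' != 0 ->
    L 0 (x' * y - x * y') (x' * z - x * z');
  plane_elim2 : forall x y z x' y' z', L x y z -> L x' y' z' ->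
    y != 0 -> y' != 0 -> y' * z - y * z' != 0 \/ y' * x - y * x' != 0 ->
    L (y' * x - y * x') 0 (y' * z - y * z');
  plane_elim3 : forall x y z x' y' z', L x y z -> L x' y' z' ->
    z != 0 -> z' != 0 -> z' * x - z * x' != 0 \/ z' * y - z * y' != 0 ->
    L (z' * x - z * x') (z' * y - z * y') 0;
  plane_fin1 : finite_set [set t | L 0 1 t];
  plane_fin2 : finite_set [set t | L t 0 1];
  plane_fin3 : finite_set [set t | L 1 t 0];
  plane_red12 : exists x y z, L x y z /\ x != y;
  plane_red23 : exists x y z, L x y z /\ y != z;
  plane_red31 : exists x y z, L x y z /\ z != x }.

(** By this symmetry it suffices to treat one position of the zero coefficient. *)
Lemma plane_closed_cycle L :
  plane_closed L -> plane_closed (fun x y z => L z x y).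
Proof.
case=> one sc e1 e2 e3 f1 f2 f3 r12 r23 r31; split=> //.
- by move=> k x y z k0; exact: sc.
- by move=> x y z x' y' z'; exact: e2.
- by move=> x y z x' y' z'; exact: e3.
- by move=> x y z x' y' z'; exact: e1.
- by have [x [y [z [h1 h2]]]] := r23; exists y, z, x.
- by have [x [y [z [h1 h2]]]] := r31; exists y, z, x.
- by have [x [y [z [h1 h2]]]] := r12; exists y, z, x.
Qed.

(** Otherwise triples with x != y and with z != x, cleared of their first coefficient, yield (0, 1,
    0) and (0, 0, 1). Removing these from (1, 1, 1) gives (1, 0, 0), and removing that one gives (0,
    1, 1), a contradiction. *)
Lemma plane_nonempty L :
  plane_closed L -> exists2 t, t != 0 & L 0 1 t.
Proof.
move=> hL; have [one sc e1 _ _ _ _ _ [x [y [z [Lx xy]]]] _] := hL.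
move=> [x' [y' [z' [Lx' zx']]]].
apply: contrapT => no.
have T0 u v : L 0 u v -> u != 0 -> v = 0.
  move=> Luv u0; apply: contrapT => /eqP v0; apply: no.
  exists (u^-1 * v); first by rewrite mulf_neq0 ?invr_eq0.
  have := sc u^-1 _ _ _ _ Luv; rewrite mulr0 mulVf //; apply.
  by rewrite invr_eq0.
have L010 : L 0 1 0.
  have [u [u0 Lu]] : exists u, u != 0 /\ exists v, L 0 u v.
    have [x0|x0] := eqVneq x 0.
      by exists y; split; [rewrite eq_sym -x0|exists z; rewrite -x0].
    exists (y - x); split; first by rewrite subr_eq0 eq_sym.
    exists (z - x); have := e1 _ _ _ _ _ _ Lx one x0 (oner_neq0 _).
    by rewrite !mul1r !mulr1; apply; left; rewrite subr_eq0 eq_sym.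
  case: Lu => v Lu; have v0 := T0 _ _ Lu u0.
  have := sc u^-1 _ _ _ _ Lu; rewrite v0 !mulr0 mulVf //; apply.
  by rewrite invr_eq0.
have L001 : L 0 0 1.
  have [v [v0 [u Lu]]] : exists v, v != 0 /\ exists u, L 0 u v.
    have [x0|x0] := eqVneq x' 0.
      by exists z'; split; [rewrite -x0|exists y'; rewrite -x0].
    exists (z' - x'); split; first by rewrite subr_eq0.
    exists (y' - x'); have := e1 _ _ _ _ _ _ Lx' one x0 (oner_neq0 _).
    by rewrite !mul1r !mulr1; apply; right; rewrite subr_eq0.
  have u0 : u = 0.
    by apply: contrapT => /eqP u0; rewrite (T0 _ _ Lu u0) eqxx in v0.
  have := sc v^-1 _ _ _ _ Lu; rewrite u0 !mulr0 mulVf //; apply.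
  by rewrite invr_eq0.
have L101 : L 1 0 1.
  have := plane_elim2 hL one L010 (oner_neq0 _) (oner_neq0 _).
  by rewrite !(mul1r, mulr0, subr0); apply; left; exact: oner_neq0.
have L100 : L 1 0 0.
  have := plane_elim3 hL L101 L001 (oner_neq0 _) (oner_neq0 _).
  by rewrite !(mul1r, mulr0, subr0); apply; left; exact: oner_neq0.
apply: no; exists 1; first exact: oner_neq0.
have := plane_elim1 hL one L100 (oner_neq0 _) (oner_neq0 _).
by rewrite !(mul1r, mulr0, subr0); apply; left; exact: oner_neq0.
Qed.

Lemma plane_menelaus L x y : plane_closed L ->
  x != 0 -> y != 0 -> L 0 1 x -> L y 0 1 -> L 1 (menelaus x y) 0.
Proof.
move=> hL x0 y0 Lx Ly.
have := plane_elim3 hL Lx Ly x0 (oner_neq0 _).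
rewrite !mul1r mulr0 subr0 sub0r => /(_ (or_intror (oner_neq0 _))).
move=> /(plane_scale hL (k := - (x * y)^-1)).
rewrite mulrNN mulVf ?mulf_neq0 // mulr0 mulr1; apply.
by rewrite oppr_eq0 invr_eq0 mulf_neq0.
Qed.

Lemma plane_cevian L x : plane_closed L -> x != 1 -> L 0 1 x -> L (cevian x) 0 1.
Proof.
move=> hL x1 Lx; have x1' : 1 - x != 0 by rewrite subr_eq0 eq_sym.
have := plane_elim2 hL (plane_one hL) Lx (oner_neq0 _) (oner_neq0 _).
rewrite !mul1r subr0 => /(_ (or_introl x1')).
move=> /(plane_scale hL (k := (1 - x)^-1)).
by rewrite mulr1 mulr0 mulVf // invr_eq0; apply.
Qed.

Lemma plane_seq L : plane_closed L -> exists s : seq F,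
  [/\ uniq s, 0 \notin s, s != [::] & forall t, t \in s <-> t != 0 /\ L 0 1 t].
Proof.
move=> hL; have [s [us hs]] : exists s : seq F, uniq s /\
    forall t, (t != 0 /\ L 0 1 t) <-> t \in s.
  apply: finite_uniq; apply: sub_finite_set (plane_fin1 hL).
  by move=> t [].
exists s; split=> // [||t]; last by rewrite hs.
  by apply/negP => /hs[]; rewrite eqxx.
have [t t0 Lt] := plane_nonempty hL.
by apply/eqP => s0; have : t \in s; [apply/hs|rewrite s0].
Qed.

(** The sets of non-zero [t], one for each position of the zero coefficient, satisfy the hypotheses
    of [triangle_singleton]. *)
Lemma plane_unique L : plane_closed L ->
  exists t, [/\ t != 0, t != 1, L 0 1 t & forall s, s != 0 -> L 0 1 s -> s = t].
Proof.
move=> hL; have hL' := plane_closed_cycle hL; have hL'' := plane_closed_cycle hL'.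
have [a [ua a0 ane ha]] := plane_seq hL.
have [b [ub b0 bne hb]] := plane_seq hL'.
have [c [uc c0 cne hc]] := plane_seq hL''.
have men0 (x y : F) : x != 0 -> y != 0 -> menelaus x y != 0.
  by move=> x0 y0; rewrite oppr_eq0 invr_eq0 mulf_neq0.
have cev0 (x : F) : x != 1 -> cevian x != 0.
  by move=> x1; rewrite invr_eq0 subr_eq0 eq_sym.
have [||||||t at_ t1] := triangle_singleton ua ub uc a0 b0 c0 ane bne cne.
- by move=> x y /ha[x0 Lx] /hb[y0 Ly]; apply/hc; split; [exact: men0|exact: (plane_menelaus hL)].
- by move=> x y /hb[x0 Lx] /hc[y0 Ly]; apply/ha; split; [exact: men0|exact: (plane_menelaus hL')].
- by move=> x y /hc[x0 Lx] /ha[y0 Ly]; apply/hb; split; [exact: men0|exact: (plane_menelaus hL'')].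
- by move=> x /ha[_ Lx] x1; apply/hb; split; [exact: cev0|exact: (plane_cevian hL)].
- by move=> x /hb[_ Lx] x1; apply/hc; split; [exact: cev0|exact: (plane_cevian hL')].
- by move=> x /hc[_ Lx] x1; apply/ha; split; [exact: cev0|exact: (plane_cevian hL'')].
have /ha[t0 Lt] : t \in a by rewrite at_ mem_head.
exists t; split=> // s s0 Ls.
have : s \in a by apply/ha.
by rewrite at_ inE => /eqP.
Qed.

(** Removing such an axis from (1, 1, 1) leaves two coefficients equal to 1, but the ratio in
    [plane_unique] is never 1. *)
Lemma plane_no_axis L : plane_closed L -> ~ L 0 1 0 /\ ~ L 0 0 1.
Proof.
move=> hL; have hL' := plane_closed_cycle hL; have hL'' := plane_closed_cycle hL'.
have no1 L' : plane_closed L' -> ~ L' 0 1 1.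
  move=> h; have [t [_ t1 _ ut]] := plane_unique h.
  by move=> /(ut _ (oner_neq0 _))/eqP; rewrite eq_sym (negPf t1).
split=> h.
  apply: (no1 _ hL').
  have := plane_elim2 hL (plane_one hL) h (oner_neq0 _) (oner_neq0 _).
  by rewrite !(mul1r, mulr0, subr0); apply; left; exact: oner_neq0.
apply: (no1 _ hL'').
have := plane_elim3 hL (plane_one hL) h (oner_neq0 _) (oner_neq0 _).
by rewrite !(mul1r, mulr0, subr0); apply; left; exact: oner_neq0.
Qed.

(** Clearing the first coefficient against (1, 1, 1) leaves a multiple of (0, 1, t), so all triples
    lie in the span of these two. *)
Lemma plane_closed_line L : plane_closed L ->
  exists t, [/\ t != 0, t != 1, L 0 1 t &
    forall x y z, L x y z -> z = (1 - t) * x + t * y].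
Proof.
move=> hL; have [t [t0 t1 Lt ut]] := plane_unique hL.
have [n1 n2] := plane_no_axis hL.
have L0 u v : L 0 u v -> v = t * u.
  move=> Lu; have [u0|u0] := eqVneq u 0; have [v0|v0] := eqVneq v 0.
  - by rewrite u0 v0 mulr0.
  - case: n2; have := plane_scale hL (k := v^-1) _ Lu.
    by rewrite u0 !mulr0 mulVf // invr_eq0; apply.
  - case: n1; have := plane_scale hL (k := u^-1) _ Lu.
    by rewrite v0 !mulr0 mulVf // invr_eq0; apply.
  - rewrite -(ut (u^-1 * v)) ?mulf_neq0 ?invr_eq0 //; first by rewrite mulrAC mulVf ?mul1r.
    have := plane_scale hL (k := u^-1) _ Lu.
    by rewrite !mulr0 mulVf // invr_eq0; apply.
exists t; split=> // x y z Lx; have [x0|x0] := eqVneq x 0.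
  by rewrite x0 mulr0 add0r; apply: L0; rewrite -x0.
have [/andP[/eqP-> /eqP->]|h] := boolP ((y == x) && (z == x)).
  by ring.
have /L0 : L 0 (y - x) (z - x).
  have := plane_elim1 hL Lx (plane_one hL) x0 (oner_neq0 _).
  rewrite !mul1r !mulr1; apply; rewrite !subr_eq0.
  by apply/orP; rewrite -negb_and.
by move/eqP; rewrite subr_eq => /eqP->; ring.
Qed.

End PlaneClosed.

(** * Systems of equations closed under elimination *)

Section Forms.
Variables (F : numFieldType) (n : nat).
Implicit Types (a b f g h u v : 'rV[F]_n) (c d e x y z p q : F) (i j k l : 'I_n).
Implicit Types (M : 'rV[F]_n -> F -> Prop).

(* M a c stands for: the hyperplane a . x = c belongs to the arrangement.
   Stability becomes closure under elimination of a coordinate, being reduced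
   and being indecomposable become form_red and form_ind, and form_not_span2
   says that there is more than one element of codimension 2. *)
Record form_closed M : Prop := FormClosed {
  form_neq0 : forall a c, M a c -> a != 0;
  form_scale : forall x a c, x != 0 -> M a c -> M (x *: a) (x * c);
  form_elim : forall i a b c d, M a c -> M b d -> a 0 i != 0 -> b 0 i != 0 ->
    b 0 i *: a - a 0 i *: b != 0 ->
    M (b 0 i *: a - a 0 i *: b) (b 0 i * c - a 0 i * d);
  form_finite : forall i, finite_set [set p : 'rV[F]_n * F | M p.1 p.2 /\ p.1 0 i = 1];
  form_red : forall i j x y, i != j -> (x != 0) || (y != 0) ->
    exists a c, M a c /\ x * a 0 i + y * a 0 j != 0;
  form_ind : forall i j, i != j -> exists a c, [/\ M a c, a 0 i != 0 & a 0 j != 0];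
  form_not_span2 : forall f c g d, exists h e, M h e /\
    forall x y, h = x *: f + y *: g -> e <> x * c + y * d }.

Lemma row_neq0 a : a != 0 -> exists i, a 0 i != 0.
Proof.
move=> a0; apply: contrapT => no; case/negP: a0; apply/eqP/rowP => i.
by rewrite mxE; apply: contrapT => /eqP h; apply: no; exists i.
Qed.

Lemma coord_neq0 a i : a 0 i != 0 -> a != 0.
Proof. by apply: contraNneq => ->; rewrite mxE. Qed.

(** Any combination that cancels coordinate [i] is a non-zero multiple of the one in [form_elim]. *)
Lemma form_comb M i a b c d p q : form_closed M -> M a c -> M b d ->
  p != 0 -> q != 0 -> a 0 i != 0 -> p * a 0 i + q * b 0 i = 0 ->
  p *: a + q *: b != 0 -> M (p *: a + q *: b) (p * c + q * d).
Proof.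
move=> hM Ma Mb p0 q0 ai0 E nz.
have bi : b 0 i = - (p / q * a 0 i).
  apply: (mulfI q0); rewrite mulrN mulrA mulrCA divff // mulr1.
  by apply/eqP; rewrite -addr_eq0 addrC E.
have bi0 : b 0 i != 0 by rewrite bi oppr_eq0 !mulf_neq0 ?invr_eq0.
set r := - (a 0 i / q).
have r0 : r != 0 by rewrite oppr_eq0 mulf_neq0 ?invr_eq0.
have Ev : b 0 i *: a - a 0 i *: b = r *: (p *: a + q *: b).
  by apply/rowP => l; rewrite !mxE bi /r; field.
have Ec : b 0 i * c - a 0 i * d = r * (p * c + q * d).
  by rewrite bi /r; field.
have := form_elim hM Ma Mb ai0 bi0; rewrite Ev Ec.
rewrite scaler_eq0 negb_or r0 nz => /(_ isT).
have ri0 : r^-1 != 0 by rewrite invr_eq0.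
by move=> /(form_scale hM ri0); rewrite scalerA mulrA mulVf // scale1r mul1r.
Qed.

Lemma form_unscale M x a c : form_closed M -> x != 0 ->
  M (x *: a) c -> M a (x^-1 * c).
Proof.
move=> hM x0 /(form_scale hM (x := x^-1)).
by rewrite scalerA mulVf // scale1r; apply; rewrite invr_eq0.
Qed.

Lemma form_const_finite M a : form_closed M -> finite_set [set c | M a c].
Proof.
move=> hM; have [->|a0] := eqVneq a 0.
  suff -> : [set c | M 0 c] = set0 by exact: finite_set0.
  by apply/seteqP; split=> // c /(form_neq0 hM); rewrite eqxx.
have [i ai] := row_neq0 a0.
have := finite_image (fun p : 'rV[F]_n * F => p.2 * a 0 i) (form_finite hM i).
apply: sub_finite_set => c /= Mc.
exists ((a 0 i)^-1 *: a, (a 0 i)^-1 * c) => /=; last by rewrite mulrAC mulVf // mul1r.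
by rewrite mxE mulVf //; split=> //; apply: form_scale => //; rewrite invr_eq0.
Qed.

Section Triple.
Variables (M : 'rV[F]_n -> F -> Prop) (i j k : 'I_n).
Hypotheses (hM : form_closed M) (ij : i != j) (jk : j != k) (ki : k != i).

(** Dividing by the coefficients of [f] turns [f] itself into (1, 1, 1). *)
Lemma triple_plane_closed f c : M f c -> f 0 i != 0 -> f 0 j != 0 -> f 0 k != 0 ->
  plane_closed (fun x y z => exists a d,
    [/\ M a d, a 0 i = x * f 0 i, a 0 j = y * f 0 j & a 0 k = z * f 0 k]).
Proof.
move=> Mf fi fj fk.
have fin l m : f 0 l != 0 -> f 0 m != 0 ->
    finite_set [set t | exists a d, [/\ M a d, a 0 l = f 0 l & a 0 m = t * f 0 m]].
  move=> fl fm.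
  have := finite_image (fun p : 'rV[F]_n * F => p.1 0 m * f 0 l / f 0 m)
    (form_finite hM l).
  apply: sub_finite_set => t /= [a [d [Ma al am]]].
  exists ((f 0 l)^-1 *: a, (f 0 l)^-1 * d) => /=; last by rewrite mxE am; field; rewrite fl fm.
  by rewrite mxE al mulVf //; split=> //; apply: form_scale => //; rewrite invr_eq0.
have red l m : l != m -> f 0 l != 0 -> f 0 m != 0 ->
    exists a d, M a d /\ a 0 l / f 0 l != a 0 m / f 0 m.
  move=> lm fl fm.
  (* These weights annihilate [f], so the equation found has coefficients at [l] and [m] that are
     not proportional to those of [f]. *)
  have [|a [d [Ma h]]] := form_red hM (x := f 0 m) (y := - f 0 l) lm; first by rewrite fm.
  exists a, d; split=> //; apply: contra h => /eqP h.
  by rewrite -[a 0 l](divfK fl) h; apply/eqP; field.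
have el l a d b e : M a d -> M b e -> a 0 l != 0 -> b 0 l != 0 -> f 0 l != 0 ->
   let r := b 0 l / f 0 l *: a - a 0 l / f 0 l *: b in
   r != 0 -> M r (b 0 l / f 0 l * d - (a 0 l / f 0 l) * e).
  move=> Ma Mb al bl fl r; rewrite /r -scaleNr -[- (_ * e)]mulNr => r0.
  apply: (form_comb hM Ma Mb) r0; rewrite ?oppr_eq0 ?mulf_neq0 ?invr_eq0 //.
    exact: al.
  by field.
split.
- by exists f, c; rewrite !mul1r.
- move=> r x y z r0 [a [d [Ma ai aj ak]]]; exists (r *: a), (r * d).
  by rewrite !mxE ai aj ak !mulrA; split=> //; exact: form_scale.
- move=> x y z x' y' z' [a [d [Ma ai aj ak]]] [b [e [Mb bi bj bk]]] x0 x0' nz.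
  have ax : a 0 i / f 0 i = x by rewrite ai mulfK.
  have bx : b 0 i / f 0 i = x' by rewrite bi mulfK.
  have := el i a d b e Ma Mb; rewrite /= ax bx => h.
  exists (x' *: a - x *: b), (x' * d - x * e).
  split; rewrite ?mxE ?ai ?bi ?aj ?bj ?ak ?bk; [|by ring..].
  apply: h => //; rewrite ?ai ?bi ?mulf_neq0 //.
  case: nz => nz; [apply: (@coord_neq0 _ j)|apply: (@coord_neq0 _ k)].
    by rewrite !mxE aj bj !mulrA -mulNr -mulrDl mulf_neq0 //; move: nz; rewrite mulNr.
  by rewrite !mxE ak bk !mulrA -mulNr -mulrDl mulf_neq0 //; move: nz; rewrite mulNr.
- move=> x y z x' y' z' [a [d [Ma ai aj ak]]] [b [e [Mb bi bj bk]]] x0 x0' nz.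
  have ax : a 0 j / f 0 j = y by rewrite aj mulfK.
  have bx : b 0 j / f 0 j = y' by rewrite bj mulfK.
  have := el j a d b e Ma Mb; rewrite /= ax bx => h.
  exists (y' *: a - y *: b), (y' * d - y * e).
  split; rewrite ?mxE ?ai ?bi ?aj ?bj ?ak ?bk; [|by ring..].
  apply: h => //; rewrite ?aj ?bj ?mulf_neq0 //.
  case: nz => nz; [apply: (@coord_neq0 _ k)|apply: (@coord_neq0 _ i)].
    by rewrite !mxE ak bk !mulrA -mulNr -mulrDl mulf_neq0 //; move: nz; rewrite mulNr.
  by rewrite !mxE ai bi !mulrA -mulNr -mulrDl mulf_neq0 //; move: nz; rewrite mulNr.
- move=> x y z x' y' z' [a [d [Ma ai aj ak]]] [b [e [Mb bi bj bk]]] x0 x0' nz.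
  have ax : a 0 k / f 0 k = z by rewrite ak mulfK.
  have bx : b 0 k / f 0 k = z' by rewrite bk mulfK.
  have := el k a d b e Ma Mb; rewrite /= ax bx => h.
  exists (z' *: a - z *: b), (z' * d - z * e).
  split; rewrite ?mxE ?ai ?bi ?aj ?bj ?ak ?bk; [|by ring..].
  apply: h => //; rewrite ?ak ?bk ?mulf_neq0 //.
  case: nz => nz; [apply: (@coord_neq0 _ i)|apply: (@coord_neq0 _ j)].
    by rewrite !mxE ai bi !mulrA -mulNr -mulrDl mulf_neq0 //; move: nz; rewrite mulNr.
  by rewrite !mxE aj bj !mulrA -mulNr -mulrDl mulf_neq0 //; move: nz; rewrite mulNr.
- apply: sub_finite_set (fin j k fj fk) => t [a [d [Ma _ aj ak]]].
  by exists a, d; rewrite aj mul1r.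
- apply: sub_finite_set (fin k i fk fi) => t [a [d [Ma ai aj ak]]].
  by exists a, d; rewrite ak mul1r.
- apply: sub_finite_set (fin i j fi fj) => t [a [d [Ma ai aj ak]]].
  by exists a, d; rewrite ai mul1r.
- have [a [d [Ma h]]] := red i j ij fi fj.
  exists (a 0 i / f 0 i), (a 0 j / f 0 j), (a 0 k / f 0 k); split=> //.
  by exists a, d; rewrite !divfK.
- have [a [d [Ma h]]] := red j k jk fj fk.
  exists (a 0 i / f 0 i), (a 0 j / f 0 j), (a 0 k / f 0 k); split=> //.
  by exists a, d; rewrite !divfK.
- have [a [d [Ma h]]] := red k i ki fk fi.
  exists (a 0 i / f 0 i), (a 0 j / f 0 j), (a 0 k / f 0 k); split=> //.
  by exists a, d; rewrite !divfK.
Qed.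

(** This is [plane_closed_line] with the scaling by [f] undone: the relation defining the plane, and
    its generator (0, 1, t). *)
Lemma triple_dependent f c : M f c -> f 0 i != 0 -> f 0 j != 0 -> f 0 k != 0 ->
  (exists x y, [/\ x != 0, y != 0 &
     forall h e, M h e -> h 0 k = x * h 0 i + y * h 0 j]) /\
  (exists v d, [/\ M v d, v 0 i = 0, v 0 j = 1 & v 0 k != 0]).
Proof.
move=> Mf fi fj fk.
have [t [t0 t1 [v [d [Mv vi vj vk]]] ht]] := plane_closed_line (triple_plane_closed Mf fi fj fk).
split.
  exists (f 0 k * (1 - t) / f 0 i), (f 0 k * t / f 0 j).
  split; rewrite ?mulf_neq0 ?invr_eq0 ?subr_eq0 //; first by rewrite eq_sym.
  move=> h e Mh; rewrite -[LHS](divfK fk).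
  rewrite (ht (h 0 i / f 0 i) (h 0 j / f 0 j) (h 0 k / f 0 k)); first by field; rewrite fi fj.
  by exists h, e; rewrite !divfK.
exists ((f 0 j)^-1 *: v), ((f 0 j)^-1 * d).
rewrite !mxE vi vj vk mul0r mulr0 mul1r mulVf // !mulf_neq0 ?invr_eq0 //; split=> //.
by apply: form_scale; rewrite ?invr_eq0.
Qed.

End Triple.
End Forms.

(** * No equation involves three coordinates *)

Section NoTriple.
Variables (F : numFieldType) (n : nat).
Implicit Types (a b f g h u v : 'rV[F]_n) (c d e x y z p q : F) (i j k l : 'I_n).
Variables (M : 'rV[F]_n -> F -> Prop).
Hypothesis hM : form_closed M.

(** Indecomposability provides an equation [g] involving [l] and [i]. It also involves [j] or [k],
    since its coefficients satisfy the relation between [i], [j] and [k]; so [triple_dependent]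
    applies to [g]. *)
Lemma triple_span i j k f c : i != j -> j != k -> k != i -> M f c ->
  f 0 i != 0 -> f 0 j != 0 -> f 0 k != 0 ->
  forall l, exists x y, forall h e, M h e -> h 0 l = x * h 0 i + y * h 0 j.
Proof.
move=> ij jk ki Mf fi fj fk l.
have [[x [y [x0 y0 hk]]] _] := triple_dependent hM ij jk ki Mf fi fj fk.
have [->|li] := eqVneq l i; first by exists 1, 0 => h e _; ring.
have [->|lj] := eqVneq l j; first by exists 0, 1 => h e _; ring.
have [->|lk] := eqVneq l k; first by exists x, y.
have [g [d [Mg gl gi]]] := form_ind hM li.
have [gj|gj] := eqVneq (g 0 j) 0; last first.
  have jl : j != l by rewrite eq_sym.
  have [[x' [y' [_ _ hl]]] _] := triple_dependent hM ij jl li Mg gi gj gl.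
  by exists x', y'.
have gk : g 0 k != 0 by rewrite (hk _ _ Mg) gj mulr0 addr0 mulf_neq0.
have ik : i != k by rewrite eq_sym.
have kl : k != l by rewrite eq_sym.
have [[x' [y' [_ _ hl]]] _] := triple_dependent hM ik kl li Mg gi gk gl.
exists (x' + y' * x), (y' * y) => h e Mh.
by rewrite (hl _ _ Mh) (hk _ _ Mh); ring.
Qed.

(* A second equation v = d' would translate the finite set of constants of the
   equations parallel to u by a non-zero amount. *)
Lemma const_unique i j k u v c d d' :
  u 0 i != 0 -> u 0 j = 0 -> u 0 k != 0 -> v 0 i = 0 -> v 0 j != 0 -> v 0 k != 0 ->
  M u c -> M v d -> M v d' -> d = d'.
Proof.
move=> ui uj uk vi vj vk Mu Md Md'.
have [s [us hs]] := finite_uniq (form_const_finite u hM).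
(* Eliminating [k] with the constant [d] and then [j] with the constant [d'] leads back to a
   multiple of [u], with a shifted constant. *)
have tr c1 : M u c1 -> M u (c1 + u 0 k / v 0 k * (d' - d)).
  move=> Mu1.
  have Mw : M (v 0 k *: u + - u 0 k *: v) (v 0 k * c1 + - u 0 k * d).
    apply: (form_comb (i := k) hM Mu1 Md); rewrite ?oppr_eq0 //; first by ring.
    apply: (@coord_neq0 _ _ _ i); rewrite !mxE vi mulr0 addr0.
    by rewrite mulf_neq0.
  have wj : (v 0 k *: u + - u 0 k *: v) 0 j = - u 0 k * v 0 j.
    by rewrite !mxE uj mulr0 add0r.
  have Eu : 1 *: (v 0 k *: u + - u 0 k *: v) + u 0 k *: v = v 0 k *: u.
    by rewrite scale1r scaleNr subrK.
  have := form_comb (i := j) hM Mw Md' (oner_neq0 _) uk.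
  rewrite Eu wj scaler_eq0 (negPf vk) (negPf (coord_neq0 ui)) => H.
  have {}H := H _ _ isT.
  have -> : c1 + u 0 k / v 0 k * (d' - d) =
      (v 0 k)^-1 * (1 * (v 0 k * c1 + - u 0 k * d) + u 0 k * d').
    by field.
  apply: form_unscale => //; apply: H; last by ring.
  by rewrite mulf_neq0 ?oppr_eq0.
have /(_ s (u 0 k / v 0 k * (d' - d)) us) := @translation_closed F.
have s0 : s != [::] by apply/eqP => s0; have : c \in s; [apply/hs|rewrite s0].
move=> /(_ s0) /(_ _)/eqP; rewrite mulf_eq0 subr_eq0 mulf_eq0 invr_eq0.
rewrite (negPf uk) (negPf vk) /= => H; apply/esym/eqP/H.
by move=> x /hs Mx; apply/hs; exact: tr.
Qed.

(** Two equations [u] and [v], each lacking one of [j] and [i], generate all left-hand sides. Their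
    constants are unique by [const_unique], which determines the constant of every equation, against
    [form_not_span2]. *)
Theorem no_triple i j k f c : i != j -> j != k -> k != i -> M f c ->
  f 0 i != 0 -> f 0 j != 0 -> f 0 k = 0.
Proof.
move=> ij jk ki Mf fi fj; apply: contrapT => /eqP fk.
have ji : j != i by rewrite eq_sym.
have ik : i != k by rewrite eq_sym.
have kj : k != j by rewrite eq_sym.
have [_ [v [dv [Mv vi vj vk]]]] := triple_dependent hM ij jk ki Mf fi fj fk.
have [_ [u [du [Mu uj ui uk]]]] := triple_dependent hM ji ik kj Mf fj fi fk.
have ext h e : M h e -> h = h 0 i *: u + h 0 j *: v.
  move=> Mh; apply/rowP => l.
  have [x [y xy]] := triple_span ij jk ki Mf fi fj fk l.
  rewrite !mxE (xy _ _ Mh) (xy _ _ Mu) (xy _ _ Mv) ui uj vi vj; ring.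
have u0 : u != 0 by apply: (@coord_neq0 _ _ _ i); rewrite ui oner_neq0.
have uu d : M u d -> d = du.
  move=> Md; apply: (@const_unique j i k v u dv); rewrite ?vj ?ui ?oner_neq0 //.
have vv d : M v d -> d = dv.
  move=> Md; apply: (@const_unique i j k u v du); rewrite ?vj ?ui ?oner_neq0 //.
have [h [e [Mh ne]]] := form_not_span2 hM u du v dv.
apply: (ne (h 0 i) (h 0 j) (ext _ _ Mh)).
have [hj|hj] := eqVneq (h 0 j) 0.
  have hi : h 0 i != 0.
    apply/negP => /eqP hi; have /negP := form_neq0 hM Mh; apply.
    by rewrite (ext _ _ Mh) hi hj !scale0r addr0.
  move: (Mh); rewrite {1}(ext _ _ Mh) hj scale0r addr0 => /(form_unscale hM hi)/uu <-.
  by rewrite mul0r addr0 mulrA mulfV // mul1r.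
have [hi|hi] := eqVneq (h 0 i) 0.
  move: (Mh); rewrite {1}(ext _ _ Mh) hi scale0r add0r => /(form_unscale hM hj)/vv <-.
  by rewrite mul0r add0r mulrA mulfV // mul1r.
(* Removing coordinate [j] by means of [v] leaves a multiple of [u], whose constant is known. *)
have := form_comb (p := 1) (q := - h 0 j) (i := j) hM Mh Mv (oner_neq0 _).
have -> : 1 *: h + - h 0 j *: v = h 0 i *: u.
  by rewrite scale1r {1}(ext _ _ Mh) scaleNr addrK.
rewrite oppr_eq0 scaler_eq0 negb_or hi u0 vj => /(_ hj hj).
rewrite mul1r mulr1 subrr => /(_ (erefl _) isT)/(form_unscale hM hi)/uu <-.
by field.
Qed.

End NoTriple.

(** * Normalisation of the coordinates *)

Section ChangeCoordinates.
Variables (F : numFieldType) (n : nat).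
Implicit Types (a b f g h u v : 'rV[F]_n) (c d e x y z p q w : F) (i j k l : 'I_n).
Implicit Types (M : 'rV[F]_n -> F -> Prop).

(* The coefficients in x of the equation a . y = c, where y_j = s_j x_j + t_j. *)
Definition change_lin (s : 'I_n -> F) a : 'rV[F]_n := \row_j (a 0 j * s j).
Definition change_const (t : 'I_n -> F) a c : F := c - \sum_j a 0 j * t j.
Definition change s t M a c := M (change_lin s a) (change_const t a c).

Let unchange_lin (s : 'I_n -> F) a : 'rV[F]_n := \row_j (a 0 j / s j).

Lemma change_linZ s x a : change_lin s (x *: a) = x *: change_lin s a.
Proof. by apply/rowP => j; rewrite !mxE mulrA. Qed.

Lemma change_linD s a b : change_lin s (a + b) = change_lin s a + change_lin s b.
Proof. by apply/rowP => j; rewrite !mxE mulrDl. Qed.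

Lemma change_constZ t x a c : change_const t (x *: a) (x * c) = x * change_const t a c.
Proof.
rewrite /change_const mulrBr mulr_sumr; congr (_ - _).
by apply: eq_bigr => j _; rewrite mxE mulrA.
Qed.

Lemma change_constD t a b c d :
  change_const t (a + b) (c + d) = change_const t a c + change_const t b d.
Proof.
rewrite /change_const addrACA -opprD -big_split /=; congr (_ - _).
by apply: eq_bigr => j _; rewrite mxE mulrDl.
Qed.

Section FixedChange.
Variables (s t : 'I_n -> F).
Hypothesis s0 : forall j, s j != 0.

Let change_linK a : change_lin s (unchange_lin s a) = a.
Proof. by apply/rowP => j; rewrite !mxE divfK. Qed.

Let unchange_linK a : unchange_lin s (change_lin s a) = a.
Proof. by apply/rowP => j; rewrite !mxE mulfK. Qed.

Lemma change_form_closed M : form_closed M -> form_closed (change s t M).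
Proof.
move=> hM.
have comb x y a b c d :
    change_lin s (x *: a - y *: b) = x *: change_lin s a - y *: change_lin s b /\
    change_const t (x *: a - y *: b) (x * c - y * d) =
      x * change_const t a c - y * change_const t b d.
  by rewrite -!scaleNr -!mulNr change_linD change_constD !change_linZ !change_constZ.
have nz a : a != 0 -> change_lin s a != 0.
  move=> /row_neq0[i ai]; apply: (@coord_neq0 _ _ _ i).
  by rewrite mxE mulf_neq0.
split.
- move=> a c /(form_neq0 hM); apply: contraNneq => ->.
  by apply/eqP/rowP => j; rewrite !mxE mul0r.
- by move=> x a c x0 Ma; rewrite /change change_linZ change_constZ; exact: form_scale.
- move=> i a b c d Ma Mb ai bi h.
  rewrite /change; have [-> ->] := comb (b 0 i) (a 0 i) a b c d.
  have [si ti] : (change_lin s a) 0 i = a 0 i * s i /\ (change_lin s b) 0 i = b 0 i * s i.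
    by rewrite !mxE.
  have := form_elim (i := i) hM Ma Mb; rewrite si ti !mulf_neq0 //.
  have -> : (b 0 i * s i) *: change_lin s a - (a 0 i * s i) *: change_lin s b =
      s i *: (b 0 i *: change_lin s a - a 0 i *: change_lin s b).
    by rewrite scalerBr !scalerA ![s i * _]mulrC.
  rewrite scaler_eq0 negb_or s0.
  have [<- _] := comb (b 0 i) (a 0 i) a b c d.
  move=> /(_ isT isT); rewrite nz // => /(_ isT)/(form_unscale hM (s0 i)).
  by congr M; rewrite -!mulrA; field.
- move=> i.
  have := finite_image (fun p : 'rV[F]_n * F => let h := unchange_lin s (s i *: p.1) in
    (h, s i * p.2 + \sum_j h 0 j * t j)) (form_finite hM i).
  apply: sub_finite_set => -[a c] /= [Ma ai].
  have si0 : (s i)^-1 != 0 by rewrite invr_eq0.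
  exists ((s i)^-1 *: change_lin s a, (s i)^-1 * change_const t a c) => /=.
    by split; [exact: form_scale|rewrite !mxE ai mul1r mulVf].
  rewrite scalerA mulrA mulfV // scale1r mul1r unchange_linK.
  by rewrite /change_const subrK.
- move=> i j x y ij xy.
  have [|a [c [Ma h]]] := form_red hM (x := x / s i) (y := y / s j) ij.
    by rewrite !mulf_eq0 !invr_eq0 !(negPf (s0 _)) !orbF.
  exists (unchange_lin s a), (c + \sum_l unchange_lin s a 0 l * t l).
  rewrite /change change_linK /change_const addrK; split=> //.
  by rewrite !mxE !mulrA ![_ * a 0 _ / _]mulrAC.
- move=> i j ij; have [a [c [Ma ai aj]]] := form_ind hM ij.
  exists (unchange_lin s a), (c + \sum_l unchange_lin s a 0 l * t l).
  by rewrite /change change_linK /change_const addrK !mxE !mulf_neq0 ?invr_eq0.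
- move=> f c g d.
  have [h [e [Mh H]]] := form_not_span2 hM (change_lin s f) (change_const t f c)
    (change_lin s g) (change_const t g d).
  exists (unchange_lin s h), (e + \sum_l unchange_lin s h 0 l * t l); split.
    by rewrite /change change_linK /change_const addrK.
  move=> x y E1 E2; apply: (H x y).
    by rewrite -[h]change_linK E1 change_linD !change_linZ.
  rewrite -!change_constZ -change_constD -E1 -E2.
  by rewrite /change_const addrK.
Qed.

End FixedChange.
End ChangeCoordinates.

(** * Equations in at most two coordinates as affine maps *)

Section Normalise.
Variables (F : numFieldType) (n : nat).
Implicit Types (a b f g h u v : 'rV[F]_n) (c d e x y z p q w : F) (i j k l : 'I_n).
Implicit Types (M : 'rV[F]_n -> F -> Prop).

Definition unit_form i : 'rV[F]_n := delta_mx 0 i.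
Definition diff_form w i j : 'rV[F]_n := unit_form i - w *: unit_form j.

Lemma unit_formE i l : unit_form i 0 l = (l == i)%:R.
Proof. by rewrite mxE eqxx. Qed.

Lemma diff_formE w i j l : diff_form w i j 0 l = (l == i)%:R - w * (l == j)%:R.
Proof. by rewrite /diff_form !mxE eqxx. Qed.

Lemma unit_form_neq0 i : unit_form i != 0.
Proof. by apply: (@coord_neq0 _ _ _ i); rewrite unit_formE eqxx oner_neq0. Qed.

(** The outcome of the normalisation. Left open are the ratios [w] and the constants of the
    equations x_i = c; [std_zero] will supply the hyperplanes x_i = 0, and [std_empty] covers the
    case where no x_i = c occurs. *)
Record standard_forms M : Prop := StandardForms {
  std_closed : form_closed M;
  std_diag : forall i j, i != j -> M (diff_form 1 i j) 0;
  std_linear : forall i j w c, i != j -> w != 0 -> M (diff_form w i j) c -> c = 0;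
  std_zero : forall i j c, M (unit_form i) c -> M (unit_form j) 0;
  std_empty : (forall i c, ~ M (unit_form i) c) -> (2 < n)%N }.

Section Support.
Variable M : 'rV[F]_n -> F -> Prop.
Hypothesis hM : form_closed M.

Lemma form_support2 i j a c : i != j -> M a c -> a 0 i != 0 -> a 0 j != 0 ->
  a = a 0 i *: diff_form (- (a 0 j / a 0 i)) i j.
Proof.
move=> ij Ma ai aj; apply/rowP => l; rewrite mxE diff_formE.
have [->|li] := eqVneq l i; first by rewrite (negPf ij) /=; ring.
have [->|lj] := eqVneq l j; first by rewrite /=; field.
rewrite (no_triple hM ij (j := j) (k := l) _ _ Ma) // 1?eq_sym //.
by rewrite /=; ring.
Qed.

Lemma form_cases a c : M a c ->
  (exists i p, [/\ a 0 i != 0, M (unit_form i) p, a = a 0 i *: unit_form i & c = a 0 i * p]) \/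
  (exists i j w d, [/\ i != j, w != 0, M (diff_form w i j) d &
     a 0 i != 0 /\ (a = a 0 i *: diff_form w i j /\ c = a 0 i * d)]).
Proof.
move=> Ma; have [i ai] := row_neq0 (form_neq0 hM Ma).
have [[j [ij aj]]|no] := pselect (exists j, i != j /\ a 0 j != 0).
  right; have E := form_support2 ij Ma ai aj.
  exists i, j, (- (a 0 j / a 0 i)), ((a 0 i)^-1 * c); split=> //.
  - by rewrite oppr_eq0 mulf_neq0 ?invr_eq0.
  - by apply: (form_unscale hM ai); rewrite -E.
  - by split=> //; split=> //; rewrite mulrA mulfV // mul1r.
left; have E : a = a 0 i *: unit_form i.
  apply/rowP => l; rewrite mxE unit_formE.
  have [->|li] := eqVneq l i; first by rewrite mulr1.
  rewrite mulr0; apply: contrapT => /eqP al; apply: no; exists l.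
  by rewrite eq_sym.
exists i, ((a 0 i)^-1 * c); split=> //; last by rewrite mulrA mulfV // mul1r.
by apply: (form_unscale hM ai); rewrite -E.
Qed.

(** With x_i = w x_j + c read as an affine map, eliminating x_j evaluates it at [p]; the next two
    lemmas invert and compose such maps. *)
Lemma unit_form_subst i j w c p : i != j -> w != 0 ->
  M (diff_form w i j) c -> M (unit_form j) p -> M (unit_form i) (w * p + c).
Proof.
move=> ij w0 Md Mp.
have E : 1 *: diff_form w i j + w *: unit_form j = unit_form i.
  by rewrite scale1r subrK.
have := form_comb (i := j) hM Md Mp (oner_neq0 _) w0.
rewrite E !mul1r [c + _]addrC; apply; last exact: unit_form_neq0.
  rewrite diff_formE eqxx [j == i]eq_sym (negPf ij) sub0r mulr1 oppr_eq0 //.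
by rewrite diff_formE unit_formE eqxx [j == i]eq_sym (negPf ij) /=; ring.
Qed.

Lemma diff_form_inv i j w c : w != 0 -> M (diff_form w i j) c ->
  M (diff_form w^-1 j i) (- (c / w)).
Proof.
move=> w0 /(form_scale hM (x := - w^-1)); rewrite oppr_eq0 invr_eq0 => /(_ w0).
suff -> : - w^-1 *: diff_form w i j = diff_form w^-1 j i.
  by rewrite mulNr mulrC.
by apply/rowP => l; rewrite mxE !diff_formE; field.
Qed.

Lemma diff_form_comp i j k w w' c c' : i != j -> j != k -> i != k ->
  w != 0 -> w' != 0 -> M (diff_form w i j) c -> M (diff_form w' j k) c' ->
  M (diff_form (w * w') i k) (w * c' + c).
Proof.
move=> ij jk ik w0 w0' Md Md'.
have E : 1 *: diff_form w i j + w *: diff_form w' j k = diff_form (w * w') i k.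
  by apply/rowP => l; rewrite !(mxE, diff_formE) /=; ring.
have := form_comb (i := j) hM Md Md' (oner_neq0 _) w0.
rewrite E !mul1r [c + _]addrC; apply.
- by rewrite diff_formE eqxx [j == i]eq_sym (negPf ij) sub0r mulr1 oppr_eq0.
- by rewrite !diff_formE eqxx [j == i]eq_sym (negPf ij) (negPf jk) /=; ring.
- apply: (@coord_neq0 _ _ _ i); rewrite diff_formE eqxx (negPf ik).
  by rewrite mulr0 subr0 oner_neq0.
Qed.

(** Eliminating x_i between x_i = w x_j + c and x_i = x_j leaves the fixed point of the affine
    map. *)
Lemma diff_form_fixpoint i j w c : i != j -> w != 1 -> M (diff_form 1 i j) 0 ->
  w != 0 -> M (diff_form w i j) c -> M (unit_form j) (c / (1 - w)).
Proof.
move=> ij w1 Md w0 Mw; have w1' : 1 - w != 0 by rewrite subr_eq0 eq_sym.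
have E : 1 *: diff_form w i j + - 1 *: diff_form 1 i j = (1 - w) *: unit_form j.
  by apply/rowP => l; rewrite !(mxE, diff_formE, unit_formE) /=; ring.
have := form_comb (i := i) hM Mw Md (oner_neq0 _) (_ : - 1 != 0).
rewrite E mulr0 !mul1r addr0 oppr_eq0 oner_eq0 => /(_ isT) H.
rewrite mulrC; apply: (form_unscale hM w1'); apply: H.
- by rewrite diff_formE eqxx (negPf ij) mulr0 subr0 oner_eq0.
- by rewrite !diff_formE eqxx (negPf ij) /=; ring.
- by rewrite scaler_eq0 negb_or w1' unit_form_neq0.
Qed.

End Support.

Lemma change_unit_form s t i c : change_lin s (unit_form i) = s i *: unit_form i /\
  change_const t (unit_form i) c = c - t i.
Proof.
split; first by apply/rowP => l; rewrite !(mxE, unit_formE); case: eqVneq => [->|_] /=; ring.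
rewrite /change_const (bigD1 i) //= big1 ?addr0 ?unit_formE ?eqxx ?mul1r //.
by move=> l li; rewrite unit_formE (negPf li) mul0r.
Qed.

Lemma change_diff_form s t w i j c :
  change_lin s (diff_form w i j) = s i *: unit_form i - (w * s j) *: unit_form j /\
  change_const t (diff_form w i j) c = c - t i + w * t j.
Proof.
split.
  apply/rowP => l; rewrite !(mxE, diff_formE, unit_formE) /=.
  by case: (eqVneq l i) => [->|_]; case: eqVneq => [->|_] /=; ring.
have E : diff_form w i j = unit_form i + - w *: unit_form j by rewrite scaleNr.
have Ec : c = c + - w * 0 by ring.
rewrite {1}Ec E change_constD change_constZ.
have [_ ->] := change_unit_form s t i c; have [_ ->] := change_unit_form s t j 0.
by ring.
Qed.

(** For each other [j], indecomposability gives an equation x_i0 = s_j x_j + t_j, whose right-hand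
    side becomes the new coordinate; the remaining pairs are linked through [i0]. *)
Lemma exists_diag M i0 : form_closed M -> exists s t, (forall j, s j != 0) /\
  forall i j, i != j -> change s t M (diff_form 1 i j) 0.
Proof.
move=> hM.
have /(_ _)/cid2-/all_sig2[s s0 hs] : forall j, exists2 st : F * F, st.1 != 0 &
    (j = i0 -> st = (1, 0)) /\
    (j != i0 -> M (unit_form i0 - st.1 *: unit_form j) st.2).
  move=> j; have [->|ji0] := eqVneq j i0.
    by exists (1, 0); rewrite ?oner_neq0.
  have [g [c [Mg gj gi]]] := form_ind hM ji0.
  exists (- (g 0 j / g 0 i0), (g 0 i0)^-1 * c) => /=.
    by rewrite oppr_eq0 mulf_neq0 ?invr_eq0.
  split=> [/eqP|_]; first by rewrite (negPf ji0).
  apply: (form_unscale hM gi); rewrite -/(diff_form _ _ _).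
  by rewrite -(form_support2 hM _ Mg gi gj) // eq_sym.
exists (fun j => (s j).1), (fun j => (s j).2); split=> //.
have {}hM : form_closed (change (fun j => (s j).1) (fun j => (s j).2) M).
  exact: change_form_closed.
have [/(_ (erefl _)) si0 _] := hs i0.
have h0 j : j != i0 -> change (fun j => (s j).1) (fun j => (s j).2) M (diff_form 1 i0 j) 0.
  move=> ji0; rewrite /change.
  have [-> ->] := change_diff_form (fun j => (s j).1) (fun j => (s j).2) 1 i0 j 0.
  rewrite si0 /= scale1r !mul1r subr0 add0r.
  by have [_] := hs j; apply.
have h1 j : j != i0 -> change (fun j => (s j).1) (fun j => (s j).2) M (diff_form 1 j i0) 0.
  by move=> /h0/(diff_form_inv hM (oner_neq0 _)); rewrite invr1 mul0r oppr0.
move=> i j ij; have [ii|ii] := eqVneq i i0; first by rewrite ii; apply: h0; rewrite -ii eq_sym.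
have [jj|jj] := eqVneq j i0; first by rewrite jj; exact: h1.
have i0j : i0 != j by rewrite eq_sym.
have := diff_form_comp hM ii i0j ij (oner_neq0 _) (oner_neq0 _) (h1 _ ii) (h0 _ jj).
by rewrite !mul1r addr0.
Qed.

End Normalise.

(** * Translating the coordinates to a common centre *)

Section Translation.
Variables (F : numFieldType) (n : nat).
Implicit Types (a b f g h u v : 'rV[F]_n) (c d e x y z p q w : F) (i j k l : 'I_n).
Implicit Types (M : 'rV[F]_n -> F -> Prop).

Lemma third_index i j : (2 < n)%N -> exists k, k != i /\ k != j.
Proof.
move=> n2; have : (0 < #|~: [set i; j]%SET|)%N.
  rewrite cardsCs finset.setCK card_ord subn_gt0.
  by rewrite cards2; apply: leq_ltn_trans n2; case: eqP.
by move/card_gt0P => [k]; rewrite !inE negb_or => /andP[ki kj]; exists k.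
Qed.

(* If some x_i = w x_j + c has w <> 1, all these affine maps preserve the finite
   set of constants p with x_i = p in the arrangement, hence fix its barycentre,
   which is the fixed point c / (1 - w); otherwise they are translations of a
   finite set. *)
Lemma exists_center M i0 i1 : form_closed M -> i0 != i1 ->
  (forall i j, i != j -> M (diff_form 1 i j) 0) ->
  ((forall i c, ~ M (unit_form F i) c) -> (2 < n)%N) ->
  exists z, (forall i c, M (unit_form F i) c -> forall j, M (unit_form F j) z) /\
    (forall i j w c, i != j -> w != 0 -> M (diff_form w i j) c -> c = z - w * z).
Proof.
move=> hM i01 diag n2.
have move_ i j c : M (unit_form F i) c -> M (unit_form F j) c.
  have [->//|ji] := eqVneq j i; move=> Mc.
  by have := unit_form_subst hM ji (oner_neq0 _) (diag _ _ ji) Mc; rewrite mul1r addr0.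
have [[p Mp]|noP] := pselect (exists p, M (unit_form F i0) p); last first.
  have no i c : ~ M (unit_form F i) c by move=> /(move_ _ i0) h; apply: noP; exists c.
  have {}n2 := n2 no.
  exists 0; split=> [i c /no //|i j w c ij w0 Mw].
  rewrite mulr0 subrr.
  have w1 : w = 1.
    apply: contrapT => /eqP w1.
    exact: (no _ _ (diff_form_fixpoint hM ij w1 (diag _ _ ij) w0 Mw)).
  (* Composition needs distinct indices; a detour through a third coordinate shows that the
     constants of x_i = x_j + d are closed under translation by [c]. *)
  subst w; have [k [ki kj]] := third_index i j n2.
  have [ik jk] : i != k /\ j != k by rewrite ![_ == k]eq_sym.
  have [s [us hs]] := finite_uniq (form_const_finite (diff_form 1 i j) hM).
  apply: (translation_closed us) => [|d /hs Md].
    by apply/eqP => s0; have : c \in s; [apply/hs|rewrite s0].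
  apply/hs; have o0 := oner_neq0 F.
  have Mkj := diff_form_comp hM ki ij kj o0 o0 (diag _ _ ki) Mw.
  have Mik := diff_form_comp hM ij jk ik o0 o0 Md (diag _ _ jk).
  rewrite !mul1r addr0 add0r in Mkj Mik.
  have := diff_form_comp hM ik kj ij o0 o0 Mik Mkj.
  by rewrite !mul1r addrC.
have [s [us hs]] := finite_uniq (form_const_finite (unit_form F i0) hM).
have s0 : s != [::] by apply/eqP => s0; have : p \in s; [apply/hs|rewrite s0].
have cl i j w c : i != j -> w != 0 -> M (diff_form w i j) c ->
    {in s, forall x, w * x + c \in s}.
  move=> ij w0 Mw x /hs /(move_ _ j) Mx; apply/hs; apply: (move_ i).
  exact: (unit_form_subst hM ij w0 Mw Mx).
have sz0 : (size s)%:R != 0 :> F by rewrite pnatr_eq0 size_eq0.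
have [[i [j [w [c [ij w0 w1 Mw]]]]]|now] :=
    pselect (exists i j w c, [/\ i != j, w != 0, w != 1 & M (diff_form w i j) c]).
  set z := (\sum_(x <- s) x) / (size s)%:R.
  have hz i' j' w' c' : i' != j' -> w' != 0 -> M (diff_form w' i' j') c' -> c' = z - w' * z.
    move=> ij' w0' Mw'; have := sum_affine_closed us w0' (cl _ _ _ _ ij' w0' Mw').
    rewrite /z => E; rewrite {1}E -mulr_natr; by field.
  exists z; split=> // k d _ l; apply: (move_ j).
  have w1' : 1 - w != 0 by rewrite subr_eq0 eq_sym.
  have -> : z = c / (1 - w) by rewrite (hz _ _ _ _ ij w0 Mw); field.
  exact: (diff_form_fixpoint hM ij w1 (diag _ _ ij) w0 Mw).
(* All ratios are 1 here, so the affine maps are translations, hence trivial, and any constant can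
   serve as centre. *)
exists p; split=> [k d _ l|i j w c ij w0 Mw]; first exact: (move_ i0).
have w1 : w = 1 by apply: contrapT => /eqP w1; apply: now; exists i, j, w, c.
subst w; rewrite mul1r subrr; apply: (translation_closed us s0) => x xs.
by have := cl _ _ _ _ ij w0 Mw x xs; rewrite mul1r.
Qed.

(** With two coordinates and no x_i = c, every ratio is 1 by [diff_form_fixpoint]; the two
    coefficients then always add up to 0, against [form_red] with weights 1 and 1. *)
Lemma only_diffs_dim M i0 i1 : form_closed M -> i0 != i1 ->
  (forall i j, i != j -> M (diff_form 1 i j) 0) ->
  (forall i c, ~ M (unit_form F i) c) -> (2 < n)%N.
Proof.
move=> hM i01 diag no; apply: contrapT => n2.
have ex k : k = i0 \/ k = i1.
  apply: contrapT => nk; apply: n2.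
  rewrite -[X in (_ < X)%N](card_ord n).
  have [k0 k1] : k != i0 /\ k != i1 by split; apply/eqP => h; apply: nk; [left|right].
  have : (#|(k |: [set i0; i1])%SET| <= #|'I_n|)%N by exact: max_card.
  by rewrite cardsU1 !inE negb_or k0 k1 cards2 i01.
have [|a [c [Ma]]] := form_red hM (x := 1) (y := 1) i01; first by rewrite oner_neq0.
case/eqP; have [[i [p [_ Mp _ _]]]|[i [j [w [d [ij w0 Mw [ai [-> _]]]]]]]] := form_cases hM Ma.
  by case: (no _ _ Mp).
have w1 : w = 1.
  apply: contrapT => /eqP w1.
  exact: (no _ _ (diff_form_fixpoint hM ij w1 (diag _ _ ij) w0 Mw)).
rewrite !mxE !eqxx w1; have i10 : (i1 == i0) = false by rewrite eq_sym (negPf i01).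
move: ij; case: (ex i) => ->; case: (ex j) => ->; rewrite ?eqxx //;
by rewrite ?i10 ?(negPf i01) => _ /=; ring.
Qed.

Lemma exists_standard M i0 i1 : form_closed M -> i0 != i1 ->
  exists s t, (forall j, s j != 0) /\ standard_forms (change s t M).
Proof.
move=> hM i01.
have [s [t [s0 diag]]] := exists_diag i0 hM.
have hM1 := change_form_closed t s0 hM.
have [z [zP zF]] := exists_center hM1 i01 diag (only_diffs_dim hM1 i01 diag).
exists s, (fun j => t j - z); split=> //.
have -> : change s (fun j => t j - z) M = change (fun=> 1) (fun=> - z) (change s t M).
  apply/funext => a; apply/funext => c; rewrite /change.
  have -> : change_lin (fun=> 1) a = a by apply/rowP => j; rewrite mxE mulr1.
  congr M; rewrite /change_const -addrA -opprD -big_split /=; congr (_ - _).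
  by apply: eq_bigr => j _; ring.
have hM2 := change_form_closed (fun=> - z) (fun=> oner_neq0 F) hM1.
have unitE i c : change (fun=> 1) (fun=> - z) (change s t M) (unit_form F i) c =
    change s t M (unit_form F i) (c + z).
  rewrite {1}/change; have [-> ->] := change_unit_form (fun=> 1) (fun=> - z) i c.
  by rewrite scale1r opprK.
have diffE w i j c : change (fun=> 1) (fun=> - z) (change s t M) (diff_form w i j) c =
    change s t M (diff_form w i j) (c + z - w * z).
  rewrite {1}/change; have [-> ->] := change_diff_form (fun=> 1) (fun=> - z) w i j c.
  by rewrite scale1r opprK mulr1 mulrN.
split=> //.
- by move=> i j ij; rewrite diffE mul1r addrK; exact: diag.
- move=> i j w c ij w0; rewrite diffE => /(zF _ _ _ _ ij w0).
  by rewrite -addrA => /(canRL (addrK _)); rewrite subrr.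
- by move=> i j c; rewrite !unitE add0r => /zP.
- move=> no; apply: (only_diffs_dim hM1 i01 diag) => i c Mc.
  by apply: (no i (c - z)); rewrite unitE subrK.
Qed.

End Translation.

(** * Finite subgroups of the unit circle *)

Section RootsOfUnity.
Variable R : realType.
Local Notation C := R[i].

Lemma expiD (x y : R) : expi (x + y) = expi x * expi y.
Proof.
by apply/eqP; rewrite /expi cosD sinD eq_complex /= eqxx addrC eqxx.
Qed.

Lemma expi0 : expi 0 = 1 :> C.
Proof. by rewrite /expi cos0 sin0. Qed.

Lemma expiX (x : R) k : expi x ^+ k = expi (k%:R * x).
Proof.
elim: k => [|k IH]; first by rewrite mul0r expi0.
by rewrite exprS IH -expiD -natr1 mulrDl mul1r addrC.
Qed.

Lemma expi_2pi : expi (2 * pi) = 1 :> C.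
Proof.
have -> : 2 * pi = pi *+ 2 :> R by rewrite mulr_natl.
by rewrite /expi cos2pi sin2pi.
Qed.

(** The real part is 1 - 2 sin(x/2)^2, and x/2 lies strictly between 0 and pi. *)
Lemma expi_neq1 (x : R) : 0 < x < 2 * pi -> expi x != 1.
Proof.
move=> /andP[x0 x1]; have h : 0 < x / 2 < pi.
  by rewrite divr_gt0 //= ltr_pdivrMr // mulrC.
have s0 : sin (x / 2) != 0 by rewrite gt_eqF // sin_gt0_pi.
rewrite /expi eq_complex /= negb_and.
have -> : x = (x / 2) *+ 2 by rewrite -mulr_natr divfK.
apply/orP; left; rewrite cos_mulr2n cos2sin2; apply: contra_neq s0 => E.
have : sin (x / 2) ^+ 2 = 0 by move: E; rewrite -mulr_natr; lra.
by move/eqP; rewrite sqrf_eq0 => /eqP.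
Qed.

(** Multiplication by x in G permutes G, so comparing products over G gives x^m = 1 with m the size
    of G. Both G and the m listed exponentials consist of m distinct roots of X^m - 1, which has no
    others. *)
Lemma finite_unity_group (G : set C) :
  finite_set G -> G 1 -> ~ G 0 -> (forall x y, G x -> G y -> G (x * y)) ->
  exists m, (0 < m)%N /\ G = Omega m.
Proof.
move=> finG G1 G0 GM.
have [s [us hs]] := finite_uniq finG.
have s_gt0 : (0 < size s)%N.
  by case: s hs {us} => // h; have /h := G1.
exists (size s); split=> //; set m := size s.
have m0 : m%:R != 0 :> R by rewrite pnatr_eq0 -lt0n.
have root_s : all m.-unity_root s.
  apply/allP => x xs; apply/unity_rootP.
  have x0 : x != 0 by apply: contra_notN G0 => /eqP <-; apply/hs.
  have cl : {in s, forall y, x * y \in s} by move=> y /hs Gy; apply/hs/GM => //; apply/hs.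
  have p0 : \prod_(y <- s) y != 0.
    rewrite prodf_seq_neq0; apply/allP => y ys; apply/implyP => _.
    by apply: contra_notN G0 => /eqP <-; apply/hs.
  apply: (mulIf p0); rewrite mul1r.
  rewrite -[RHS](perm_big _ (perm_map_closed us _ cl)) /=; last by move=> y z _ _ /(mulfI x0).
  rewrite big_map big_split /= big_const_seq count_predT.
  by rewrite iter_mulr_1.
pose o : seq C := [seq expi (2 * pi * k%:R / m%:R) | k <- iota 1 m].
have root_o : all m.-unity_root o.
  apply/allP => _ /mapP[k _ ->]; apply/unity_rootP.
  rewrite expiX mulrC divfK // mulrC -expiX expi_2pi expr1n //.
have uo : uniq o.
  rewrite map_inj_in_uniq ?iota_uniq // => k l.
  wlog kl : k l / (k < l)%N.
    move=> H hk hl e; have [kl|lk|//] := ltngtP k l; first exact: H.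
    exact/esym/H.
  rewrite !mem_iota => /andP[k1 _] /andP[_]; rewrite add1n ltnS => lm e.
  have : expi (2 * pi * (l - k)%:R / m%:R) = 1 :> C.
    have n0 : expi (2 * pi * k%:R / m%:R) != 0 :> C.
      apply/negP => /eqP z; have := expiD (2 * pi * k%:R / m%:R) (- (2 * pi * k%:R / m%:R)).
      by rewrite subrr expi0 z mul0r => /eqP; rewrite oner_eq0.
    apply: (mulIf n0); rewrite mul1r -expiD e; congr expi.
    by rewrite natrB; [field|exact: ltnW].
  move/eqP; rewrite (negPf (expi_neq1 _)) //.
  rewrite divr_gt0 ?mulr_gt0 ?pi_gt0 ?ltr0n ?subn_gt0 //=.
  rewrite ltr_pdivrMr ?ltr0n // ltr_pM2l ?mulr_gt0 ?pi_gt0 // ltr_nat.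
  by apply: leq_trans lm; rewrite ltn_subrL k1 (leq_ltn_trans _ kl).
have so : s =i o.
  pose t := undup (s ++ o).
  have st : (size t <= m)%N.
    apply: max_unity_roots; rewrite ?undup_uniq // all_undup.
    by apply/allP => x; rewrite mem_cat => /orP[/(allP root_s)|/(allP root_o)].
  have [|_ ht] := uniq_min_size us _ st; first by move=> x xs; rewrite mem_undup mem_cat xs.
  have zo : size o = m by rewrite size_map size_iota.
  have [|||_ ht'] := @uniq_min_size _ o t; rewrite ?zo //.
    by move=> x xo; rewrite mem_undup mem_cat xo orbT.
  by move=> x; rewrite ht ht'.
apply/seteqP; split=> x.
  move/hs; rewrite so => /mapP[k]; rewrite mem_iota add1n ltnS => kk ->.
  by exists k.
case=> k /= kk <-; apply/hs; rewrite so; apply: map_f.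
by rewrite mem_iota add1n ltnS.
Qed.

End RootsOfUnity.

(** * Hyperplanes and their equations *)

Section Codimension.
Variables (R : realType) (n : nat).
Local Notation C := R[i].
Local Notation V := 'rV[C]_n.

Lemma affine_codim_inj k l (S : set V) :
  affine_of_codim k S -> affine_of_codim l S -> k = l.
Proof.
have sub (p q : V) (U W : {vspace V}) : [set x | x - p \in U] = [set x | x - q \in W] ->
    (U <= W)%VS.
  move=> E; apply/subvP => x xU.
  have h y : y - p \in U -> y - q \in W.
    by move=> yU; have : [set x | x - p \in U] y by []; rewrite E.
  have h1 := h (x + p); have h2 := h p; rewrite addrK in h1; rewrite subrr mem0v in h2.
  have := memvB (h1 xU) (h2 isT).
  by rewrite opprB addrA subrK addrK.
move=> [p [U [dU SU]]] [q [W [dW SW]]].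
have UW : \dim U = \dim W.
  by apply/eqP; rewrite eqn_leq !dimvS //; [apply: (sub q p)|apply: (sub p q)]; rewrite -SU -SW.
by apply/eqP; rewrite -(eqn_add2l (\dim U)) dU UW dW.
Qed.

Lemma affine_codim0 : affine_of_codim 0 [set: V].
Proof.
exists 0, fullv; split; first by rewrite addn0 dimvf /dim /= mul1n.
by apply/seteqP; split=> // x _ /=; exact: memvf.
Qed.

Lemma affine_codim_solutions k (B : 'M[C]_(n, k)) (e : 'rV[C]_k) :
  (forall y, exists p : V, p *m B = y) -> affine_of_codim k [set p | p *m B = e].
Proof.
move=> surj; have [p0 Ep0] := surj e.
pose f : 'Hom(V, 'rV[C]_k) := linfun (mulmxr B).
exists p0, (lker f); split.
  have := limg_ker_dim f fullv.
  have -> : (f @: fullv)%VS = fullv.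
    apply/eqP; rewrite eqEsubv subvf /=; apply/subvP => y _.
    have [p <-] := surj y; have -> : p *m B = f p by rewrite lfunE.
    by rewrite memv_img ?memvf.
  by rewrite capfv !dimvf /dim /= !mul1n.
apply/seteqP; split=> p /=; rewrite memv_ker lfunE /= mulmxBl Ep0 subr_eq0; last by move/eqP.
by move->.
Qed.

End Codimension.

Section Equations.
Variables (R : realType) (n : nat) (X : coordsys R n).
Local Notation C := R[i].
Local Notation V := 'rV[C]_n.
Local Notation coord := Defs.coord.
Implicit Types (a b f g h : V) (p q : V) (c d e t x y : C) (i j : 'I_n).

Definition value a p : C := \sum_j a 0 j * coord X j p.
Definition hyp a c : set V := [set p | value a p = c].
Definition point (z : V) : V := (z - cs_shift X) *m invmx (cs_mx X).

Lemma coords_point z : coords X (point z) = z.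
Proof. by rewrite /coords /point -mulmxA mulVmx ?cs_unit // mulmx1 subrK. Qed.

Lemma coord_shift i j t p :
  coord X j (t *: basis_vec X i + p) = t * (j == i)%:R + coord X j p.
Proof.
rewrite /coord /coords mulmxDl -scalemxAl /basis_vec -row_mul mulVmx ?cs_unit //.
by rewrite !mxE -addrA [j == i]eq_sym.
Qed.

Lemma valueE a p : value a p = (coords X p *m a^T) 0 0.
Proof. by rewrite mxE; apply: eq_bigr => j _; rewrite [a^T _ _]mxE mulrC. Qed.

Lemma value_comb x y a b p : value (x *: a + y *: b) p = x * value a p + y * value b p.
Proof.
rewrite /value !mulr_sumr -big_split /=; apply: eq_bigr => j _.
by rewrite !mxE mulrDl !mulrA.
Qed.

Lemma valueZ x a p : value (x *: a) p = x * value a p.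
Proof. by rewrite -[x *: a]addr0 -[0](scale0r a) value_comb mul0r addr0. Qed.

Lemma value_shift a i t p : value a (t *: basis_vec X i + p) = t * a 0 i + value a p.
Proof.
rewrite /value [in RHS](bigD1 i) //= [LHS](bigD1 i) //= coord_shift eqxx mulr1.
rewrite mulrDr -!addrA [a 0 i * t]mulrC; do 2 congr (_ + _).
by apply: eq_bigr => j ji; rewrite coord_shift (negPf ji) mulr0 add0r.
Qed.

Lemma hypZ x a c : x != 0 -> hyp (x *: a) (x * c) = hyp a c.
Proof.
move=> x0; apply/seteqP; split=> p; rewrite /hyp /= valueZ; first exact: mulfI.
by move->.
Qed.

Lemma hyp_point a i c q : a 0 i != 0 -> hyp a c (((c - value a q) / a 0 i) *: basis_vec X i + q).
Proof. by move=> ai; rewrite /hyp /= value_shift divfK // subrK. Qed.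

Lemma hyp_not_full a c : a != 0 -> hyp a c != setT.
Proof.
move=> /row_neq0[i ai]; apply/eqP => E.
have := hyp_point (c + 1) 0 ai; set p := (_ *: _ + _) => h.
have : hyp a c p by rewrite E.
rewrite /hyp /= in h *; rewrite h => /eqP.
by rewrite -subr_eq0 addrAC subrr add0r oner_eq0.
Qed.

(** Moving a point of the smaller set along a_i e_j - a_j e_i keeps it there, so the second equation
    gives b_j a_i = b_i a_j. *)
Lemma hyp_sub a b c d : a != 0 -> b != 0 -> hyp a c `<=` hyp b d ->
  exists x, [/\ x != 0, b = x *: a & d = x * c].
Proof.
move=> /row_neq0[i ai] b0 sub.
have [q hq] : exists q, value a q = c by eexists; exact: (hyp_point c 0 ai).
have E j : b 0 j * a 0 i = b 0 i * a 0 j.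
  have : hyp a c ((- a 0 j) *: basis_vec X i + (a 0 i *: basis_vec X j + q)).
    by rewrite /hyp /= !value_shift hq; ring.
  move=> /sub; rewrite /hyp /= !value_shift (sub _ hq : value b q = d) => /eqP.
  rewrite addrA -subr_eq0 addrK mulNr addrC subr_eq0 => /eqP E.
  by rewrite mulrC E mulrC.
have Eb : b = (b 0 i / a 0 i) *: a.
  by apply/rowP => j; rewrite mxE mulrAC -E mulfK.
exists (b 0 i / a 0 i); split=> //.
  by apply: contraNneq b0 => h; rewrite Eb h scale0r.
by rewrite -(sub _ hq : value b q = d) {1}Eb valueZ hq.
Qed.

Lemma hyp_codim1 a c : a != 0 -> affine_of_codim 1 (hyp a c).
Proof.
move=> /row_neq0[i ai].
have -> : hyp a c = [set p | p *m (cs_mx X *m a^T) = (c - (cs_shift X *m a^T) 0 0)%:M].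
  apply/seteqP; split=> p; rewrite /hyp /= valueE /coords mulmxDl mulmxA.
    by move=> <-; apply/matrixP => k l; rewrite !ord1 !mxE addrK.
  by move->; rewrite [LHS]mxE mxE subrK.
apply: affine_codim_solutions => y.
exists ((y 0 0 / a 0 i) *: basis_vec X i).
rewrite mulmxA -scalemxAl /basis_vec -row_mul mulVmx ?cs_unit // -scalemxAl -row_mul mul1mx.
by apply/matrixP => k l; rewrite !ord1 !mxE divfK.
Qed.

Lemma hyp_cap_codim2 a b c d i j : a 0 i * b 0 j - a 0 j * b 0 i != 0 ->
  affine_of_codim 2 (hyp a c `&` hyp b d) /\ (hyp a c `&` hyp b d) !=set0.
Proof.
move=> D.
pose B : 'M[C]_(n, 1 + 1) := cs_mx X *m row_mx a^T b^T.
pose e : 'rV[C]_(1 + 1) := row_mx (c - (cs_shift X *m a^T) 0 0)%:M (d - (cs_shift X *m b^T) 0 0)%:M.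
have E : hyp a c `&` hyp b d = [set p | p *m B = e].
  apply/seteqP; split=> p; rewrite /B /e /= mulmxA mul_mx_row.
    rewrite /hyp /= !valueE /coords !mulmxDl => -[<- <-].
    by congr row_mx; apply/matrixP => k l; rewrite !ord1 !mxE addrK.
  move=> /eq_row_mx[Ea Eb].
  by rewrite /hyp /= !valueE /coords !mulmxDl Ea Eb; split; rewrite [LHS]mxE mxE subrK.
have surj (y : 'rV[C]_(1 + 1)) : exists p : V, p *m B = y.
  pose u := y 0 (lshift 1 ord0); pose v := y 0 (rshift 1 ord0).
  (* Cramer's rule in the directions [i] and [j]. *)
  exists (((u * b 0 j - v * a 0 j) / (a 0 i * b 0 j - a 0 j * b 0 i)) *: basis_vec X i +
     ((a 0 i * v - b 0 i * u) / (a 0 i * b 0 j - a 0 j * b 0 i)) *: basis_vec X j).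
  rewrite /B mulmxA mulmxDl -!scalemxAl /basis_vec -!row_mul mulVmx ?cs_unit //.
  rewrite mulmxDl -!scalemxAl -!row_mul !mul1mx !row_row_mx !scale_row_mx add_row_mx.
  apply/matrixP => k l; rewrite !ord1; case: (split_ordP l) => l' ->; rewrite !ord1.
    by rewrite row_mxEl !mxE -/u; field.
  by rewrite row_mxEr !mxE -/v; field.
split; first by rewrite E; exact: affine_codim_solutions.
by have [p Ep] := surj e; exists p; rewrite E.
Qed.

Lemma coords_sub p q : p - q = \sum_j (coord X j p - coord X j q) *: basis_vec X j.
Proof.
have -> : p - q = (coords X p - coords X q) *m invmx (cs_mx X).
  by rewrite /coords opprD addrACA subrr addr0 -mulmxBl mulmxK ?cs_unit.
rewrite mulmx_sum_row; apply: eq_bigr => j _; congr (_ *: _).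
by rewrite /Defs.coord; move: (coords X p) (coords X q) => u w; rewrite !mxE.
Qed.

(** Projecting along the direction space [W] onto a complementary line and reading a coordinate
    there gives a functional with kernel [W]; its values on the basis vectors are the
    coefficients. *)
Lemma hyperplane_hyp H : hyperplane H -> exists a c, a != 0 /\ H = hyp a c.
Proof.
move=> [p [W [dW ->]]].
have [v vW] : exists v, v \notin W.
  apply: contrapT => no; have : (fullv <= W)%VS.
    by apply/subvP => v _; apply/negPn/negP => h; apply: no; exists v.
  by move/dimvS; rewrite dimvf /dim /= mul1n -[X in (X <= _)%N]dW addn1 ltnn.
have v0 : v != 0 by apply: contraNneq vW => ->; exact: mem0v.
have [l vl] := row_neq0 v0.
set U := <[v]>%VS.
have UW : (U :&: W = 0)%VS.
  apply/eqP; rewrite -subv0; apply/subvP => x; rewrite memv_cap => /andP[/vlineP[k ->]].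
  have [->|k0] := eqVneq k 0; first by rewrite scale0r !mem0v.
  by move=> /(memvZ k^-1); rewrite scalerA mulVf // scale1r (negPf vW).
have sum : (U + W)%VS = fullv.
  apply/eqP; rewrite eqEdim subvf /= dimvf /dim /= mul1n dimv_disjoint_sum //.
  by rewrite dim_vline v0 addnC dW leqnn.
pose f (x : V) := (daddv_pi U W x) 0 l.
have fW (x : V) : (x \in W) = (f x == 0).
  have WU : (W :&: U = 0)%VS by rewrite capvC.
  have Ex : daddv_pi U W x + daddv_pi W U x = x.
    by apply: daddv_pi_add => //; rewrite sum memvf.
  apply/idP/eqP => [xW|fx].
    move: Ex; rewrite (daddv_pi_id WU xW) => /eqP; rewrite -subr_eq0 addrK => /eqP h.
    by rewrite /f h mxE.
  have : daddv_pi U W x \in U by exact: memv_pi.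
  move=> /vlineP[k Ek]; move: fx; rewrite /f Ek mxE => /eqP.
  rewrite mulf_eq0 (negPf vl) orbF => /eqP k0.
  by rewrite -Ex Ek k0 scale0r add0r memv_pi.
pose a : V := \row_j f (basis_vec X j).
have fE q q' : f (q - q') = value a q - value a q'.
  rewrite /f coords_sub linear_sum summxE /value -sumrB; apply: eq_bigr => j _.
  by rewrite linearZ !mxE -mulrBr mulrC.
exists a, (value a p); split.
  apply: contraNneq vW => a0; rewrite fW -[v]subr0 fE a0 /value.
  by rewrite !big1 ?subrr // => j _; rewrite mxE mul0r.
apply/seteqP; split=> q; rewrite /hyp /= fW fE subr_eq0; first by move/eqP.
by move->.
Qed.

End Equations.

(** * From arrangements to systems of equations *)

Section ArrangementForms.
Variables (R : realType) (n : nat) (X : coordsys R n).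
Local Notation C := R[i].
Local Notation V := 'rV[C]_n.
Local Notation coord := Defs.coord.
Variable A : set (set V).
Implicit Types (a b f g h : V) (p q : V) (c d e t x y : C) (i j : 'I_n).

Definition forms a c : Prop := a != 0 /\ A (hyp X a c).

(** Stability only yields intersections of members. A hyperplane of this kind lies in some member,
    and is equal to it by [hyp_sub]. *)
Lemma hyp_intersection_mem a c : arrangement A -> a != 0 ->
  intersections A (hyp X a c) -> A (hyp X a c).
Proof.
move=> [_ Ahyp] a0 [_ [B [BA E]]].
have [[K BK]|noB] := pselect (exists K, B K); last first.
  have /eqP[] := hyp_not_full X c a0; rewrite E; apply/seteqP; split=> // p _ K BK.
  by case: noB; exists K.
have [b [d [b0 EK]]] := hyperplane_hyp X (Ahyp _ (BA _ BK)).
have [x [x0 bx dx]] : exists x, [/\ x != 0, b = x *: a & d = x * c].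
  apply: (hyp_sub (X := X)) => //; rewrite E -EK; exact: bigcap_inf.
by have := BA _ BK; rewrite EK bx dx hypZ.
Qed.

(** Translating the intersection of the two hyperplanes along x_i sweeps out the hyperplane of the
    eliminated equation. *)
Lemma stable_elim i a b c d : arrangement A -> stable X A ->
  forms a c -> forms b d -> a 0 i != 0 -> b 0 i != 0 ->
  b 0 i *: a - a 0 i *: b != 0 ->
  forms (b 0 i *: a - a 0 i *: b) (b 0 i * c - a 0 i * d).
Proof.
move=> arrA stA [a0 Aa] [b0 Ab] ai bi r0; split=> //.
have [j rj] := row_neq0 r0.
have [|cod ne] := @hyp_cap_codim2 _ _ X a b c d i j.
  by move: rj; rewrite !mxE -oppr_eq0 opprB [b 0 i * _]mulrC.
have SL : intersections_codim A 2 (hyp X a c `&` hyp X b d).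
  split=> //; split=> //; exists [set hyp X a c; hyp X b d]; split.
    by move=> K [->|->].
  by rewrite bigcap_setU !bigcap_set1.
set r := _ - _; set e := _ - _.
apply: hyp_intersection_mem => //.
suff <- : translates (basis_vec X i) (hyp X a c `&` hyp X b d) = hyp X r e.
  exact: stA.
have rval q : value X r q = b 0 i * value X a q - a 0 i * value X b q.
  by rewrite /r -scaleNr value_comb mulNr.
apply/seteqP; split=> q.
    move=> [t [y [[ya yb] ->]]]; rewrite /hyp /= rval !value_shift ya yb /e; ring.
  rewrite /hyp /= rval => qe.
  exists (- ((c - value X a q) / a 0 i)), (((c - value X a q) / a 0 i) *: basis_vec X i + q).
  split; last by rewrite scaleNr addKr.
  split; first exact: hyp_point.
  rewrite /hyp /= value_shift; apply: (mulfI ai).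
  have -> : a 0 i * ((c - value X a q) / a 0 i * b 0 i + value X b q) =
    b 0 i * c - (b 0 i * value X a q - a 0 i * value X b q) by field.
  by rewrite qe /e; ring.
Qed.

Lemma forms_finite i : arrangement A ->
  finite_set [set p : V * C | forms p.1 p.2 /\ p.1 0 i = 1].
Proof.
move=> [finA _].
(* [g] recovers the only equation of a hyperplane with coefficient 1 at [i]; the default (0, 0) is
   for hyperplanes without one. *)
pose g H := xget (0, 0) [set p : V * C | [/\ p.1 != 0, p.1 0 i = 1 & H = hyp X p.1 p.2]].
apply: sub_finite_set (finite_image g finA) => -[a c] /= [[a0 Aa] ai].
exists (hyp X a c) => //; rewrite /g; case: xgetP => [[b d] _ /= [b0 bi E]|/(_ (a, c))[]] //.
have [x [x0 bx dx]] : exists x, [/\ x != 0, b = x *: a & d = x * c].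
  by apply: (hyp_sub (X := X)) => //; rewrite E.
have x1 : x = 1 by rewrite -bi bx mxE ai mulr1.
by rewrite bx dx x1 scale1r mul1r.
Qed.

Lemma hyperplane_forms H : arrangement A -> A H -> exists a c, forms a c /\ H = hyp X a c.
Proof.
move=> [_ Ahyp] AH; have [a [c [a0 E]]] := hyperplane_hyp X (Ahyp _ AH).
by exists a, c; split=> //; split=> //; rewrite -E.
Qed.

Lemma forms_ind i j : arrangement A -> indecomposable X A -> i != j ->
  exists a c, [/\ forms a c, a 0 i != 0 & a 0 j != 0].
Proof.
move=> arrA ind.
have tr k a c : a != 0 -> translates (basis_vec X k) (hyp X a c) = setT -> a 0 k != 0.
  move=> a0 T; apply/negP => /eqP ak; have /eqP[] := hyp_not_full X c a0.
  rewrite -T; apply/seteqP; split=> q.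
    by move=> qh; exists 0, q; rewrite scale0r add0r.
  by move=> [t [y [yh ->]]]; rewrite /hyp /= value_shift ak mulr0 add0r.
wlog ij : i j / (i < j)%N.
  move=> H nij; have [ij|ji|/val_inj ij] := ltngtP i j; first exact: H.
    by have [|a [c [? ? ?]]] := H _ _ ji; rewrite 1?eq_sym //; exists a, c.
  by rewrite ij eqxx in nij.
move=> _; have [H [[AH Ti] [_ Tj]]] := ind i j ij.
have [a [c [[a0 Aa] E]]] := hyperplane_forms arrA AH.
by exists a, c; split=> //; [apply: (tr i a c)|apply: (tr j a c)]; rewrite -?E.
Qed.

(** If two equations generated all others, any two distinct members would intersect in the common
    solution set [Z], so [Z] would be the only possible element of codimension 2. *)
Lemma forms_not_span2 : arrangement A -> (`I_2 #<= intersections_codim A 2)%card ->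
  forall f c g d, exists h e, forms h e /\
    forall x y, h = x *: f + y *: g -> e <> x * c + y * d.
Proof.
move=> arrA card f c g d; apply: contrapT => no.
have span h e : forms h e -> exists x y, h = x *: f + y *: g /\ e = x * c + y * d.
  move=> Fh; apply: contrapT => no'; apply: no; exists h, e; split=> // x y E1 E2.
  by apply: no'; exists x, y.
pose Z := hyp X f c `&` hyp X g d.
have uniqS S : intersections_codim A 2 S -> S = Z.
  move=> [[_ [B [BA ES]]] cod].
  have [[H1 BH1]|noB] := pselect (exists H, B H); last first.
    have ST : S = setT.
      by rewrite ES; apply/seteqP; split=> // p _ K BK; case: noB; exists K.
    by rewrite ST in cod; have := affine_codim_inj cod (affine_codim0 _ _).
  have [[H2 [BH2 H12]]|noB] := pselect (exists H, B H /\ H <> H1); last first.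
    have SH : S = H1.
      rewrite ES; apply/seteqP; split=> [p|p pH K BK]; first exact.
      by have [->//|ne] := pselect (K = H1); case: noB; exists K.
    by rewrite SH in cod; have := affine_codim_inj cod (arrA.2 _ (BA _ BH1)).
  have [h1 [e1 [F1 E1]]] := hyperplane_forms arrA (BA _ BH1).
  have [h2 [e2 [F2 E2]]] := hyperplane_forms arrA (BA _ BH2).
  have [x1 [y1 [h1E e1E]]] := span _ _ F1.
  have [x2 [y2 [h2E e2E]]] := span _ _ F2.
  (* A vanishing determinant would make the two equations proportional and the hyperplanes equal. *)
  have D : x1 * y2 - x2 * y1 != 0.
    apply/negP => /eqP D; apply: H12; rewrite E1 E2.
    have prop k : x2 = k * x1 -> y2 = k * y1 -> hyp X h2 e2 = hyp X h1 e1.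
      move=> xk yk; have hk : h2 = k *: h1.
        by rewrite h2E h1E xk yk scalerDr !scalerA.
      have ek : e2 = k * e1 by rewrite e2E e1E xk yk; ring.
      have k0 : k != 0 by apply: contraNneq F2.1 => k0; rewrite hk k0 scale0r.
      by rewrite hk ek hypZ.
    have {}D : x1 * y2 = x2 * y1 by apply/eqP; rewrite -subr_eq0 D.
    have [x10|x10] := eqVneq x1 0.
      have y10 : y1 != 0.
        by apply: contraNneq F1.1 => y10; rewrite h1E x10 y10 !scale0r addr0.
      move/eqP: D; rewrite x10 mul0r eq_sym mulf_eq0 (negPf y10) orbF => /eqP x20.
      by apply: (prop (y2 / y1)); rewrite ?x10 ?x20 ?mulr0 // divfK.
    apply: (prop (x2 / x1)); first by rewrite divfK.
    by apply: (mulfI x10); rewrite D; field.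
  have Zsub H : A H -> Z `<=` H.
    move=> AH p [pf pg]; have [h [e [Fh ->]]] := hyperplane_forms arrA AH.
    have [x [y [-> ->]]] := span _ _ Fh.
    by rewrite /hyp /= value_comb (pf : value X f p = c) (pg : value X g p = d).
  rewrite ES; apply/seteqP; split=> p pB; last by move=> K BK; apply: Zsub => //; exact: BA.
  have := pB _ BH1; have := pB _ BH2; rewrite E1 E2 /hyp /=.
  rewrite h1E h2E e1E e2E !value_comb => P2 P1.
  split; rewrite /hyp /=; apply: (mulfI D).
    have -> : (x1 * y2 - x2 * y1) * value X f p = y2 * (x1 * value X f p + y1 * value X g p)
       - y1 * (x2 * value X f p + y2 * value X g p) by ring.
    by rewrite P1 P2; ring.
  have -> : (x1 * y2 - x2 * y1) * value X g p = x1 * (x2 * value X f p + y2 * value X g p)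
     - x2 * (x1 * value X f p + y1 * value X g p) by ring.
  by rewrite P1 P2; ring.
have L2Z : intersections_codim A 2 `<=` [set Z] by move=> S /uniqS.
have := card_le_trans card (subset_card_le L2Z).
by rewrite (card_le_eqr card_set1) card_le_II.
Qed.

End ArrangementForms.

(** * Reducedness in terms of equations *)

Section Reduction.
Variable R : realType.
Local Notation C := R[i].
Local Notation coord := Defs.coord.

Lemma exists_coordsys n (X : coordsys R n) (s : 'S_n) (a b : 'I_n -> C) :
  (forall j, a j != 0) -> exists Y : coordsys R n,
    forall j p, coord Y j p = a j * coord X (s j) p + b j.
Proof.
move=> a0; pose B := cs_mx X *m perm_mx s^-1 *m diag_mx (\row_j a j).
have BU : B \in unitmx.
  rewrite !unitmx_mul cs_unit unitmx_perm /= unitmxE det_diag unitfE.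
  by apply/prodf_neq0 => j _; rewrite mxE.
exists (CoordSys (\row_j (a j * cs_shift X 0 (s j) + b j)) BU) => j p.
have E : (p *m B) 0 j = (p *m cs_mx X) 0 (s j) * a j.
  by rewrite !mulmxA -col_permE mul_mx_diag [LHS]mxE [X in X * _]mxE [X in _ * X]mxE.
rewrite /Defs.coord /coords /= [LHS]mxE E [X in _ + X = _]mxE [in RHS]mxE; ring.
Qed.

Lemma exists_perm2 (T : finType) (k0 k1 i j : T) : k0 != k1 -> i != j ->
  exists s : {perm T}, s k0 = i /\ s k1 = j.
Proof.
move=> k01 ij; exists (tperm k1 (tperm k0 i j) * tperm k0 i)%g.
have k1k0 : k1 != k0 by rewrite eq_sym.
have jk0 : tperm k0 i j != k0.
  by apply: contra_neq ij => h; rewrite -[j](tpermK k0 i) h tpermL.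
by rewrite !permM tpermL tpermK (tpermD k1k0 jk0) tpermL.
Qed.

(** The two coordinates enter every equation only through x_i + z x_j. Permuted to the last two
    places, they can be merged by [merge_last 1 z]. *)
Lemma ratio_reducible m (X : coordsys R m.+2) (A : set (set 'rV[C]_m.+2)) i j z :
  arrangement A -> i != j -> (forall a c, forms X A a c -> a 0 j = z * a 0 i) ->
  reducible X A.
Proof.
move=> arrA ij ratio.
pose wd (l : 'I_m.+1) : 'I_m.+2 := widen_ord (leq_pred m.+2) l.
have [s [s0 s1]] : exists s : 'S_m.+2, s (wd ord_max) = i /\ s ord_max = j.
  by apply: exists_perm2 => //; rewrite -val_eqE /= neq_ltn ltnSn.
have [|Y HY] := exists_coordsys X s (a := fun=> 1) (fun=> 0); first by move=> _; exact: oner_neq0.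
have {}HY l p : coord Y l p = coord X (s l) p by rewrite HY mul1r addr0.
exists Y; split.
  by exists s, (fun=> 1), (fun=> 0); split=> [_|l p]; rewrite ?oner_neq0 // HY mul1r addr0.
pose mrg p := merge_last 1 z (coords Y p).
(* A section of [mrg], with last coordinate 0; preimages under it form the arrangement in the
   smaller space. *)
pose sec (w : 'rV[C]_m.+1) : 'rV[C]_m.+2 :=
  point Y (\row_l (if (l < m.+1)%N then w 0 (inord l) else 0)).
have mrgE p (l : 'I_m.+1) :
    mrg p 0 l = coord Y (wd l) p + (if l == ord_max then z * coord Y ord_max p else 0).
  rewrite /mrg /merge_last mxE -/(wd l) !ltnS.
  have [->|lm] := eqVneq l ord_max.
    rewrite ltnn mul1r; congr (_ + _ * _); rewrite /Defs.coord; congr (coords _ _ _ _).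
    by apply: val_inj; rewrite /= modn_small.
  by rewrite addr0 ltn_neqAle -ltnS ltn_ord andbT -[m]/(val (@ord_max m)) val_eqE lm.
have mrgK w : mrg (sec w) = w.
  apply/rowP => l; rewrite mrgE /Defs.coord /sec coords_point !mxE /= ltnn ltn_ord mulr0.
  by rewrite inord_val; case: ifP => _; rewrite addr0.
pose red (a : 'rV[C]_m.+2) : 'rV[C]_m.+1 := \row_l a 0 (s (wd l)).
have valE a c p : forms X A a c -> value X a p = \sum_l red a 0 l * mrg p 0 l.
  move=> Fa; rewrite /value (reindex_inj (@perm_inj _ s)) /= big_ord_recr /= s1 (ratio _ _ Fa).
  rewrite -s1 -HY.
  under [RHS]eq_bigr do rewrite mrgE mulrDr mxE.
  rewrite big_split /=; congr (_ + _).
    apply: eq_bigr => l _; have -> : widen_ord (leqnSn m.+1) l = wd l by exact: val_inj.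
    by rewrite HY.
  rewrite (bigD1 ord_max) //= big1 ?addr0 => [|l /negPf->]; last by rewrite mulr0.
  by rewrite eqxx s0; ring.
exists 1, z, [set [set w | H (sec w)] | H in A]; split; first exact: oner_neq0.
  split; first exact: (finite_image _ arrA.1).
  move=> _ [H AH <-]; have [a [c [Fa ->]]] := hyperplane_forms X arrA AH.
  pose S := @CoordSys R m.+1 1%:M 0 (unitmx1 _ _).
  have -> : [set w | hyp X a c (sec w)] = hyp S (red a) c.
    have vS w : value S (red a) w = \sum_l red a 0 l * w 0 l.
      by apply: eq_bigr => l _; rewrite /Defs.coord /coords /= mulmx1 addr0.
    by apply/seteqP; split=> w; rewrite /hyp /= (valE a c) // mrgK vS.
  apply: hyp_codim1; apply: contraNneq Fa.1 => r0; apply/eqP/rowP => k.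
  rewrite [RHS]mxE.
  have r l : a 0 (s (wd l)) = 0.
    by have := congr1 (fun M : 'rV[C]_m.+1 => M 0 l) r0; rewrite !mxE.
  rewrite -[k](permKV s); case: (unliftP ord_max ((s^-1)%g k)) => [l|] ->.
    by rewrite -(r l); congr (a 0 (s _)); apply: val_inj; rewrite /= /bump leqNgt ltn_ord.
  by rewrite s1 (ratio _ _ Fa) -s0 r mulr0.
have pull H : A H -> H = [set p | H (sec (mrg p))].
  move=> AH; have [a [c [Fa ->]]] := hyperplane_forms X arrA AH.
  by apply/seteqP; split=> p; rewrite /hyp /= !(valE a c) // mrgK.
apply/seteqP; split=> H.
  by move=> AH; exists [set w | H (sec w)]; [exists H|rewrite [RHS]pull].
by move=> [_ [H' AH' <-] <-]; rewrite -/(mrg _) -pull.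
Qed.

Lemma forms_red n (X : coordsys R n) (A : set (set 'rV[C]_n)) i j x y :
  arrangement A -> reduced X A -> i != j -> (x != 0) || (y != 0) ->
  exists a c, forms X A a c /\ x * a 0 i + y * a 0 j != 0.
Proof.
case: n X A i j => [|[|m]] X A i j; [by case: i|by rewrite !ord1 eqxx|].
move=> arrA redA ij xy; apply: contrapT => no; apply: redA.
have {no} E a c : forms X A a c -> x * a 0 i + y * a 0 j = 0.
  by move=> Fa; apply: contrapT => /eqP h; apply: no; exists a, c.
(* For y = 0 the relation makes a_i vanish: the ratio is 0 with [i] and [j] exchanged. *)
have [y0|y0] := eqVneq y 0.
  apply: (@ratio_reducible _ X A j i 0) => //; first by rewrite eq_sym.
  move=> a c /E; rewrite y0 in xy *; rewrite eqxx orbF in xy.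
  by rewrite !mul0r addr0 => /eqP; rewrite mulf_eq0 (negPf xy) => /eqP.
apply: (@ratio_reducible _ X A i j (- (x / y))) => // a c /E e.
apply: (mulfI y0); rewrite mulrA mulrN mulrCA divff // mulr1 mulNr.
by apply/eqP; rewrite -addr_eq0 addrC e.
Qed.

Theorem forms_closed n (X : coordsys R n) (A : set (set 'rV[C]_n)) :
  arrangement A -> stable X A -> reduced X A -> indecomposable X A ->
  (`I_2 #<= intersections_codim A 2)%card -> form_closed (forms X A).
Proof.
move=> arrA stA redA indA card; split.
- by move=> a c [].
- by move=> x a c x0 [a0 Aa]; split; rewrite ?scaler_eq0 ?negb_or ?x0 ?hypZ.
- by move=> i a b c d; exact: stable_elim.
- by move=> i; exact: forms_finite.
- by move=> i j x y; exact: forms_red.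
- by move=> i j; exact: forms_ind.
- exact: forms_not_span2.
Qed.

End Reduction.

(** * The standard form *)

Section StandardArrangement.
Variables (R : realType) (n : nat).
Local Notation C := R[i].
Local Notation V := 'rV[C]_n.
Local Notation coord := Defs.coord.
Local Notation unit_form := (unit_form C).
Implicit Types (c d w : C) (i j k l : 'I_n).

Lemma change_forms (X Y : coordsys R n) (A : set (set V)) (s t : 'I_n -> C) :
  (forall j, s j != 0) -> (forall j p, coord Y j p = s j * coord X j p + t j) ->
  change s t (forms X A) = forms Y A.
Proof.
move=> s0 HY; apply/funext => a; apply/funext => c.
have -> : forms Y A a c = (a != 0 /\ A (hyp X (change_lin s a) (change_const t a c))).
  rewrite /forms; congr (_ /\ A _).
  have E p : value Y a p = value X (change_lin s a) p + \sum_j a 0 j * t j.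
    rewrite /value -big_split /=; apply: eq_bigr => j _.
    by rewrite HY mxE; ring.
  apply/seteqP; split=> p; rewrite /hyp /change_const /= E.
    by move=> <-; rewrite addrK.
  by move->; rewrite subrK.
rewrite /change /forms; congr (is_true _ /\ _); congr negb.
apply/eqP/eqP => [h|->]; last by apply/rowP => j; rewrite !mxE mul0r.
apply/rowP => j; have := congr1 (fun M : V => M 0 j) h; rewrite !mxE => /eqP.
by rewrite mulf_eq0 (negPf (s0 j)) orbF => /eqP.
Qed.

Variables (Y : coordsys R n) (A : set (set V)).
Hypotheses (arrA : arrangement A) (std : standard_forms (forms Y A)).
Let M := forms Y A.
Let hM : form_closed M := std_closed std.

Lemma hyp_unit i c : hyp Y (unit_form i) c = [set p | coord Y i p = c].
Proof.
apply/seteqP; split=> p; rewrite /hyp /value /= (bigD1 i) //= unit_formE eqxx mul1r;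
  rewrite big1 ?addr0 // => j ji; by rewrite unit_formE (negPf ji) mul0r.
Qed.

Lemma hyp_diff w i j : hyp Y (diff_form w i j) 0 = [set p | coord Y i p = w * coord Y j p].
Proof.
have E p : value Y (diff_form w i j) p = coord Y i p - w * coord Y j p.
  have -> : diff_form w i j = 1 *: unit_form i + - w *: unit_form j.
    by rewrite scale1r scaleNr.
  rewrite value_comb mul1r mulNr.
  by congr (_ - _ * _); [have := hyp_unit i (coord Y i p)|have := hyp_unit j (coord Y j p)];
    move/seteqP => [_ /(_ p)]; apply.
apply/seteqP; split=> p; rewrite /hyp /= E; first by move/eqP; rewrite subr_eq0 => /eqP.
by move->; rewrite subrr.
Qed.

Lemma unit_form_indep i j c : M (unit_form i) c -> M (unit_form j) c.
Proof.
have [->//|ji] := eqVneq j i; move=> Mc.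
have := unit_form_subst hM ji (oner_neq0 _) (std_diag std ji) Mc.
by rewrite mul1r addr0.
Qed.

Lemma unit_form_scale i j k w c : i != j -> w != 0 -> M (diff_form w i j) 0 ->
  M (unit_form k) c -> M (unit_form k) (w * c).
Proof.
move=> ij w0 Mw /(unit_form_indep j) Mc; apply: (unit_form_indep (i := i)).
by have := unit_form_subst hM ij w0 Mw Mc; rewrite addr0.
Qed.

Lemma standard_cases H : A H ->
  (exists i c, M (unit_form i) c /\ H = [set p | coord Y i p = c]) \/
  (exists i j w, [/\ (i < j)%N, w != 0, M (diff_form w i j) 0 &
     H = [set p | coord Y i p = w * coord Y j p]]).
Proof.
move=> AH; have [a [c [Fa ->]]] := hyperplane_forms Y arrA AH.
have [[i [p [ai Mp Ea Ec]]]|[i [j [w [d [ij w0 Mw [ai [Ea Ec]]]]]]]] := form_cases hM Fa.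
  by left; exists i, p; split=> //; rewrite Ea Ec hypZ // hyp_unit.
have d0 := std_linear std ij w0 Mw; rewrite d0 in Mw Ec.
right; rewrite Ea Ec hypZ // hyp_diff.
have [lij|lji|/val_inj eij] := ltngtP i j; last by rewrite eij eqxx in ij.
  by exists i, j, w.
exists j, i, w^-1; split; [exact: lji|by rewrite invr_eq0| |].
  by have := diff_form_inv hM w0 Mw; rewrite mul0r oppr0.
apply/seteqP; split=> p /= ->; first by rewrite mulKf.
by rewrite mulVKf.
Qed.

(** The ratios [W] are kept apart from [Omega m] because for n = 2 they need not fill the group. *)
Lemma standard_union (W : set C) m r (alpha : 'I_r -> C) i0 p0 :
  M (unit_form i0) p0 ->
  (forall w i j, W w -> (i < j)%N -> M (diff_form w i j) 0) ->
  (forall w i j, (i < j)%N -> w != 0 -> M (diff_form w i j) 0 -> W w) ->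
  @Omega R m 1 ->
  (forall w c, Omega m w -> M (unit_form i0) c -> M (unit_form i0) (w * c)) ->
  (forall u, M (unit_form i0) (alpha u)) ->
  (forall c, c != 0 -> M (unit_form i0) c -> exists u, alpha u = c) ->
  A = diag_arr Y W `|` const_arr Y m alpha `|` zero_arr Y.
Proof.
move=> Mp0 W1 W2 O1 OM al1 al2; apply/seteqP; split=> H.
  move=> /standard_cases[[i [c [Mc ->]]]|[i [j [w [ij w0 Mw ->]]]]]; last first.
    by left; left; exists w, i, j; split=> //; exact: W2 ij w0 Mw.
  have [->|c0] := eqVneq c 0; first by right; exists i.
  have [j <-] := al2 c c0 (unit_form_indep i0 Mc).
  by left; right; exists 1, i, j; split=> //; rewrite mul1r.
case=> [[[w [i [j [Ww ij ->]]]]|[w [i [j [Ow ->]]]]]|[i ->]].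
- by rewrite -hyp_diff; have [] := W1 _ _ _ Ww ij.
- rewrite -hyp_unit.
  by have [] := unit_form_indep i (OM _ _ Ow (al1 j)).
- by rewrite -hyp_unit; have [] := std_zero std i Mp0.
Qed.

(** All non-zero constants are listed, not one per orbit of the roots of unity; repetitions in
    [const_arr] are harmless. *)
Lemma constants_enum i0 : exists r (alpha : 'I_r -> C),
  [/\ forall u, alpha u != 0, forall u, M (unit_form i0) (alpha u) &
    forall c, c != 0 -> M (unit_form i0) c -> exists u, alpha u = c].
Proof.
have [s [us hs]] := finite_uniq (form_const_finite (unit_form i0) hM).
pose s' := [seq c <- s | c != 0].
have al (u : 'I_(size s')) : tnth (in_tuple s') u \in s' by rewrite mem_tnth.
exists (size s'), (tnth (in_tuple s')); split=> [j|j|c c0 Mc].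
- by have := al j; rewrite mem_filter => /andP[].
- by have := al j; rewrite mem_filter => /andP[_ /hs].
- have cs : c \in s' by rewrite mem_filter c0; apply/hs.
  have [j ->] := tnthP (in_tuple s') c cs.
  by exists j.
Qed.

(** Composing with x_a = x_b replaces one index at a time, as long as the two indices stay
    different. *)
Lemma diff_form_indep i j k l w : (2 < n)%N -> i != j -> k != l -> w != 0 ->
  M (diff_form w i j) 0 -> M (diff_form w k l) 0.
Proof.
move=> n2 ij kl w0 Mw; have o0 := oner_neq0 C.
have right_ a b b' : a != b -> a != b' -> M (diff_form w a b) 0 -> M (diff_form w a b') 0.
  have [->//|bb'] := eqVneq b b'; move=> ab ab' Mab.
  have := diff_form_comp hM ab bb' ab' w0 o0 Mab (std_diag std bb').
  by rewrite mulr1 mulr0 addr0.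
have left_ a a' b : a != b -> a' != b -> M (diff_form w a b) 0 -> M (diff_form w a' b) 0.
  have [->//|aa'] := eqVneq a' a; move=> ab ab' Mab.
  have := diff_form_comp hM aa' ab ab' o0 w0 (std_diag std aa') Mab.
  by rewrite !mul1r addr0.
have [kj|kj] := eqVneq k j; last first.
  exact: (right_ _ _ _ kj kl (left_ _ _ _ ij kj Mw)).
(* For k = j the left index cannot be replaced first; the pair moves by way of a third index. *)
have [m [mi mj]] := third_index i j n2.
rewrite eq_sym in mi; have km : k != m by rewrite kj eq_sym.
exact: (right_ _ _ _ km kl (left_ _ _ _ mi km (right_ _ _ _ ij mi Mw))).
Qed.

Lemma ratios_finite i j : i != j -> finite_set [set w | M (diff_form w i j) 0].
Proof.
move=> ij; have := finite_image (fun p : V * C => - p.1 0 j) (form_finite hM i).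
apply: sub_finite_set => w /= Mw; exists (diff_form w i j, 0) => /=.
  by rewrite diff_formE eqxx (negPf ij) mulr0 subr0.
by rewrite diff_formE eqxx eq_sym (negPf ij) sub0r mulr1 opprK.
Qed.

End StandardArrangement.

(** * The cases n = 2 and n >= 3 *)

Section Cases.
Variable R : realType.
Local Notation C := R[i].
Local Notation unit_form := (unit_form C).

Lemma Omega1 : @Omega R 1 = [set 1].
Proof.
apply/seteqP; split=> w.
  by move=> [[|[|k]] //= _ <-]; rewrite mulr1 divr1 expi_2pi.
by move=> ->; exists 1%N => //; rewrite mulr1 divr1 expi_2pi.
Qed.

Lemma standard_planar n (Y : coordsys R n) (A : set (set 'rV[C]_n)) :
  n = 2%N -> arrangement A -> standard_forms (forms Y A) ->
  exists (m r : nat) (alpha : 'I_r -> C),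
    [/\ (0 < m)%N, forall j, alpha j != 0, (1 <= r)%N &
      exists W : set C, [/\ W 1, W `<=` Omega m &
        A = diag_arr Y W `|` const_arr Y m alpha `|` zero_arr Y]].
Proof.
move=> n2; move: Y A; rewrite n2 => Y A arrA std; have hM := std_closed std.
pose i0 : 'I_2 := ord0; pose i1 : 'I_2 := ord_max.
have lt2 (i j : 'I_2) : (i < j)%N -> i = i0 /\ j = i1.
  by case: i j => [[|[|//]] hi] [[|[|//]] hj] //= _; split; apply: val_inj.
have i01 : i0 != i1 by [].
have [p0 Mp0] : exists p, forms Y A (unit_form i0) p.
  apply: contrapT => no; have /std_empty : forall i c, ~ forms Y A (unit_form i) c.
    by move=> i c Mc; apply: no; exists c; exact: (unit_form_indep std i0 Mc).
  by move=> /(_ std).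
have M0 := std_zero std i0 Mp0.
have [r [alpha [al0 alM alE]]] := constants_enum std i0.
(* If 0 were the only constant, all equations would be combinations of x_1 = 0 and x_2 = 0, against
   [form_not_span2]. *)
have [p [p_neq0 Mp]] : exists p, p != 0 /\ forms Y A (unit_form i0) p.
  have [h [e [Fh]]] := form_not_span2 hM (unit_form i0) 0 (unit_form i1) 0.
  have hE : h = h 0 i0 *: unit_form i0 + h 0 i1 *: unit_form i1.
    apply/rowP => l; rewrite !mxE /=.
    by case: l => [[|[|//]] hl]; rewrite /= ?(mulr0, mulr1, addr0, add0r);
      congr (h 0 _); apply: val_inj.
  move=> /(_ _ _ hE); rewrite !mulr0 addr0 => e0.
  have [[i [p [hi Mp _ Ee]]]|[i [j [w [d [ij w0 Mw [_ [_ Ee]]]]]]]] := form_cases hM Fh.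
    exists p; split; last exact: (unit_form_indep std i0 Mp).
    by apply: contra_not_neq e0 => p0'; rewrite Ee p0' mulr0.
  by case: e0; rewrite Ee (std_linear std ij w0 Mw) mulr0.
(* The ratios w of the lines x_1 = w x_2 need not form a group, but they lie in
   the group of all w preserving the constants. *)
pose G : set C := [set w | w != 0 /\
  forall c, forms Y A (unit_form i0) c -> forms Y A (unit_form i0) (w * c)].
have G1 : G 1 by split; [exact: oner_neq0|move=> c; rewrite mul1r].
have [m [m0 GE]] : exists m, (0 < m)%N /\ G = Omega m.
  apply: finite_unity_group => //.
  - have := finite_image (fun q => q / p) (form_const_finite (unit_form i0) hM).
    apply: sub_finite_set => w [_ Gw]; exists (w * p); first exact: Gw.
    by rewrite mulfK.
  - by case; rewrite eqxx.
  - move=> x y [x0 Gx] [y0 Gy]; split; first by rewrite mulf_neq0.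
    by move=> c Mc; rewrite -mulrA; apply: Gx; exact: Gy.
pose W : set C := [set w | w != 0 /\ forms Y A (diff_form w i0 i1) 0].
exists m, r, alpha; split=> //.
  by have [[j jr] _] := alE p p_neq0 Mp; exact: leq_ltn_trans jr.
exists W; split.
- by split; [exact: oner_neq0|exact: (std_diag std i01)].
- move=> w [w0 Mw]; rewrite -GE; split=> // c Mc.
  exact: (unit_form_scale std i01 w0 Mw Mc).
- apply: (standard_union arrA std Mp0); [..|exact: alM|exact: alE].
  + by move=> w i j [_ Mw] /lt2[-> ->].
  + by move=> w i j /lt2[-> ->] w0 Mw.
  + by rewrite -GE.
  + by move=> w c; rewrite -GE => -[_ Gw]; exact: Gw.
Qed.

(** For n = 3 all equations would be combinations of two differences of coordinates, against
    [form_not_span2]. *)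
Lemma standard_diffs_dim n (Y : coordsys R n) (A : set (set 'rV[C]_n)) :
  arrangement A -> standard_forms (forms Y A) ->
  (forall i c, ~ forms Y A (unit_form i) c) ->
  (forall i j w, i != j -> w != 0 -> forms Y A (diff_form w i j) 0 -> w = 1) ->
  (3 < n)%N.
Proof.
move=> arrA std no only1; have n2 := std_empty std no.
have hM := std_closed std.
rewrite ltn_neqAle n2 andbT; apply/eqP => n3.
case: _ / n3 Y A arrA std no only1 hM {n2} => Y A arrA std no only1 hM.
pose j0 : 'I_3 := ord0; pose j1 : 'I_3 := Ordinal (isT : (1 < 3)%N); pose j2 : 'I_3 := ord_max.
have span i : exists x y, diff_form 1 i j0 =
    x *: diff_form 1 j1 j0 + y *: diff_form 1 j2 j0 :> 'rV[C]_3.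
  have j_eq (k l : 'I_3) : val k = val l -> k = l by exact: val_inj.
  case: i => [[|[|[|//]]] hi].
  - exists 0, 0; rewrite !scale0r addr0 (j_eq (Ordinal hi) j0) //.
    by rewrite /diff_form scale1r subrr.
  - by exists 1, 0; rewrite scale0r addr0 scale1r (j_eq (Ordinal hi) j1).
  - by exists 0, 1; rewrite scale0r add0r scale1r (j_eq (Ordinal hi) j2).
have [h [e [Fh H]]] := form_not_span2 hM (diff_form 1 j1 j0) 0 (diff_form 1 j2 j0) 0.
have [[i [p [_ Mp _ _]]]|[i [j [w [d [ij w0 Mw [_ [hE eE]]]]]]]] := form_cases hM Fh.
  exact: (no i p).
have d0 := std_linear std ij w0 Mw; rewrite d0 in Mw eE.
have w1 := only1 i j w ij w0 Mw; rewrite w1 in hE.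
have [x [y xy]] := span i; have [x' [y' xy']] := span j.
apply: (H (h 0 i * (x - x')) (h 0 i * (y - y'))); last by rewrite eE !mulr0 addr0.
rewrite -!scalerA -scalerDr {1}hE; congr (_ *: _).
have -> : diff_form 1 i j = diff_form 1 i j0 - diff_form 1 j j0 :> 'rV[C]_3.
  by rewrite /diff_form !scale1r opprB addrA subrK.
by rewrite xy xy' opprD addrACA -!scalerBl.
Qed.

Lemma standard_spatial n (Y : coordsys R n) (A : set (set 'rV[C]_n)) :
  (2 < n)%N -> arrangement A -> standard_forms (forms Y A) ->
  exists (m r : nat) (alpha : 'I_r -> C),
    [/\ (0 < m)%N, forall j, alpha j != 0 &
      [/\ A = diag_arr Y (Omega m), m = 1%N & (3 < n)%N] \/
      A = diag_arr Y (Omega m) `|` const_arr Y m alpha `|` zero_arr Y].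
Proof.
move=> n2 arrA std; have hM := std_closed std.
pose i0 := Ordinal (ltnW (ltnW n2)); pose i1 := Ordinal (ltnW n2).
have i01 : i0 != i1 by [].
have [[p0 Mp0]|noP] := pselect (exists p, forms Y A (unit_form i0) p).
  have [r [alpha [al0 alM alE]]] := constants_enum std i0.
  pose G : set C := [set w | w != 0 /\ forms Y A (diff_form w i0 i1) 0].
  have G1 : G 1 by split; [exact: oner_neq0|exact: (std_diag std i01)].
  have [m [m0 GE]] : exists m, (0 < m)%N /\ G = Omega m.
    apply: finite_unity_group; [|exact: G1| |].
    - by apply: sub_finite_set (ratios_finite std i01) => w [_ Mw]; exact: Mw.
    - by case; rewrite eqxx.
    - move=> x y [x0 Gx] [y0 Gy]; split; first by rewrite mulf_neq0.
      (* Moving the second ratio to the pair (i1, k) makes the two composable. *)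
      have [k [k0 k1]] := third_index i0 i1 n2.
      have [k0' k1'] : i0 != k /\ i1 != k by rewrite ![_ == k]eq_sym.
      have Gy' := diff_form_indep std n2 i01 k1' y0 Gy.
      have := diff_form_comp hM i01 k1' k0' x0 y0 Gx Gy'; rewrite mulr0 addr0.
      exact: (diff_form_indep std n2 k0' i01 (mulf_neq0 x0 y0)).
  exists m, r, alpha; split; [exact: m0|exact: al0|right].
  apply: (standard_union arrA std Mp0); [..|exact: alM|exact: alE].
  + move=> w i j; rewrite -GE => -[w0 Mw] ij.
    apply: (diff_form_indep std n2 i01 _ w0 Mw).
    by rewrite -val_eqE neq_ltn ij.
  + move=> w i j ij w0 Mw; rewrite -GE; split; first exact: w0.
    apply: (diff_form_indep std n2 _ i01 w0 Mw).
    by rewrite -val_eqE neq_ltn ij.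
  + by rewrite -GE; exact: G1.
  + move=> w c; rewrite -GE => -[w0 Gw].
    exact: (unit_form_scale std i01 w0 Gw).
have no i c : ~ forms Y A (unit_form i) c.
  by move=> Mc; apply: noP; exists c; exact: (unit_form_indep std i0 Mc).
have only1 i j w : i != j -> w != 0 -> forms Y A (diff_form w i j) 0 -> w = 1.
  move=> ij w0 Mw; apply: contrapT => /eqP w1.
  exact: (no _ _ (diff_form_fixpoint hM ij w1 (std_diag std ij) w0 Mw)).
(* Only the hyperplanes x_i = x_j are left, so m = 1 and there are no constants. *)
exists 1%N, 0%N, (fun=> 0); split=> //; first by case.
left; split=> //; last exact: (standard_diffs_dim arrA std no only1).
rewrite Omega1; apply/seteqP; split=> H.
  move=> /(standard_cases arrA std)[[i [c [/no//]]]|[i [j [w [ij w0 Mw ->]]]]].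
  have nij : i != j by rewrite -val_eqE neq_ltn ij.
  by exists w, i, j; split=> //; exact: (only1 i j w nij w0 Mw).
move=> [w [i [j [-> ij ->]]]]; rewrite -hyp_diff.
have nij : i != j by rewrite -val_eqE neq_ltn ij.
by have [_ AH] := std_diag std nij; exact: AH.
Qed.

End Cases.

Unset Implicit Arguments.
Set Strict Implicit.

Theorem theorem2p1 (R : realType) (n : nat) (X : coordsys R n)
    (A : set (set 'rV[R[i]]_n)) :
  arrangement A ->
  stable X A -> reduced X A -> indecomposable X A ->
  (`I_2 #<= intersections_codim A 2)%card ->
  exists Y : coordsys R n, admissible X Y /\
  exists (m r : nat) (alpha : 'I_r -> R[i]),
    [/\ (0 < m)%N,
        (forall j, alpha j != 0),
        (n = 2%N ->
           (1 <= r)%N /\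
           exists W : set R[i],
             [/\ W 1, W `<=` Omega m &
                 A = diag_arr Y W `|` const_arr Y m alpha `|` zero_arr Y]) &
        ((3 <= n)%N ->
           [/\ A = diag_arr Y (Omega m), m = 1%N & (3 < n)%N] \/
           A = diag_arr Y (Omega m) `|` const_arr Y m alpha `|` zero_arr Y)].
Proof.
move=> arrA stA redA indA card.
have admX : admissible X X.
  by exists 1%g, (fun=> 1), (fun=> 0); split=> [j|j p]; rewrite ?oner_neq0 // perm1 mul1r addr0.
have [n2|n2] := ltnP 1 n; last first.
  (* For n <= 1 both clauses are vacuous. *)
  exists X; split=> //; exists 1%N, 0%N, (fun=> 0); split=> [//|[]//|n2'|n3].
    by rewrite n2' in n2.
  by have := leq_trans n3 n2.
have hM := forms_closed arrA stA redA indA card.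
have i01 : Ordinal (ltnW n2) != Ordinal n2 by [].
have [s [t [s0 std]]] := exists_standard hM i01.
have [Y HY] := exists_coordsys X 1%g t s0.
have {}HY j p : Defs.coord Y j p = s j * Defs.coord X j p + t j by rewrite HY perm1.
rewrite (change_forms A s0 HY) in std.
exists Y; split.
  by exists 1%g, s, t; split=> // j p; rewrite perm1.
have [n3|n3] := ltnP 2 n.
  have [m [r [alpha [m0 al0 AE]]]] := standard_spatial n3 arrA std.
  exists m, r, alpha; split=> [//|//|n2'|_]; last exact: AE.
  by rewrite n2' in n3.
have E2 : n = 2%N by apply/eqP; rewrite eqn_leq n2 n3.
have [m [r [alpha [m0 al0 r0 AE]]]] := standard_planar E2 arrA std.
by exists m, r, alpha; split=> [//|//|_|//]; split.
Qed.
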